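(* Let $V$ be a positive definite quadratic space over $\mathbb{Q}$ with symmetric bilinear form $b$, $\varphi(v)=b(v,v)$, and let $L=\mathbb{Z}v_1+\cdots+\mathbb{Z}v_n$ be a lattice with $\mathbb{Q}L=V$, of even rank $n\geq 6$, with diagonal Gram matrix $\langle a_1,\dots,a_n\rangle$, $a_j$ positive integers, $\gcd(a_1,\dots,a_n)=1$. Let $c\in\mathbb{Z}$, $N\in\mathbb{Z}_{>0}$ odd with $\gcd(c,N)=1$, $\nu=-\frac{c}{N}(v_1+\cdots+v_n)$, $X=L+\nu$, and let $h\in\mathbb{Q}$, $h\neq0$, satisfy $h-\sum_{j=1}^n a_j(c/N)^2\in 8N^{-1}\mathbb{Z}$. Write $L_2\cong\langle b_12^{r_1},\dots,b_n2^{r_n}\rangle$ with $b_i\in\mathbb{Z}_2^\times$ and $r_1\leq\cdots\leq r_n$, and suppose that $[r_1,r_2,r_3,r_4]$ is one of: $[0,0,0,i]$ with $0\leq i\leq 2$; $[0,0,1,i]$ with $1\leq i\leq 3$; $[0,1,1,i]$ with $1\leq i\leq 2$; $[0,1,2,i]$ with $2\leq i\leq 3$. Then there is a positive number $d(L)$ depending only on $L$ such that \[ d(L)\leq b_2(h,\lambda,0)\leq 2. \]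
   Context: $V_2=V\otimes\mathbb{Q}_2$, $L_2=L\otimes\mathbb{Z}_2$, $X_2=L_2+\nu$, and $\lambda_2$ is the characteristic function of $X_2$. For $z\in\mathbb{Q}_2$, $\mathbf{e}_2(z):=e^{-2\pi i y}$ where $y\in\mathbb{Z}[1/2]$ with $z-y\in\mathbb{Z}_2$. Haar measures: $\int_{L_2}dv=1$ on $V_2$ and $\int_{\mathbb{Z}_2}d\sigma=1$ on $\mathbb{Q}_2$. The local density is $b_2(h,\lambda,0):=\int_{\mathbb{Q}_2}\int_{V_2}\mathbf{e}_2(\sigma(\varphi(v)-h))\lambda_2(v)\,dv\,d\sigma$. *)

(* Defs.v *)
From HB Require Import structures.
From mathcomp Require Import all_boot all_order all_algebra.
From mathcomp Require Import fraction sesquilinear complex.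
From mathcomp Require Import all_classical all_reals all_analysis.

Set Implicit Arguments.
Unset Strict Implicit.
Unset Printing Implicit Defensive.

Import Order.TTheory GRing.Theory Num.Theory.

Local Open Scope classical_set_scope.
Local Open Scope ring_scope.

(* The 2-adic integers as the inverse limit of the rings Z/2^k: [x k] is the
   representative in [0, 2^k) of the image of x in Z/2^k. The bound
   [x k < 2 ^ k] is a consequence of the coherence condition. *)
Record Z2 := MkZ2 {
  res :> nat -> nat ;
  res_coh : forall k, res k = (res k.+1 %% 2 ^ k)%N }.

HB.instance Definition _ := gen_eqMixin Z2.
HB.instance Definition _ := gen_choiceMixin Z2.

Lemma Z2_ext (x y : Z2) : (forall k, x k = y k) -> x = y.
Proof.
case: x y => [x hx] [y hy] /= xy.
have e : x = y by apply: funext.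
by subst y; congr MkZ2; apply: Prop_irrelevance.
Qed.

Lemma res_mod (x : Z2) k : (x k %% 2 ^ k)%N = x k.
Proof. by rewrite res_coh modn_mod. Qed.

Lemma res_leq (x : Z2) j k : (j <= k)%N -> (x k %% 2 ^ j)%N = x j.
Proof.
move=> /subnKC <-; elim: (k - j)%N => [|m IH]; first by rewrite addn0 res_mod.
rewrite addnS -[RHS]IH (res_coh x (j + m)) modn_dvdm //.
by rewrite dvdn_exp2l // leq_addr.
Qed.

Lemma mod2S a k : ((a %% 2 ^ k.+1) %% 2 ^ k = a %% 2 ^ k)%N.
Proof. by rewrite modn_dvdm // dvdn_exp2l. Qed.

Lemma Z2_zero_coh k : (0 = 0 %% 2 ^ k)%N.
Proof. by rewrite mod0n. Qed.
Definition Z2_zero := MkZ2 Z2_zero_coh.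

Lemma Z2_one_coh k : (1 %% 2 ^ k = (1 %% 2 ^ k.+1) %% 2 ^ k)%N.
Proof. by rewrite mod2S. Qed.
Definition Z2_one := MkZ2 Z2_one_coh.

Lemma Z2_add_coh (x y : Z2) k :
  ((x k + y k) %% 2 ^ k = ((x k.+1 + y k.+1) %% 2 ^ k.+1) %% 2 ^ k)%N.
Proof. by rewrite mod2S (res_coh x) (res_coh y) modnDm. Qed.
Definition Z2_add x y := MkZ2 (Z2_add_coh x y).

Lemma Z2_mul_coh (x y : Z2) k :
  ((x k * y k) %% 2 ^ k = ((x k.+1 * y k.+1) %% 2 ^ k.+1) %% 2 ^ k)%N.
Proof. by rewrite mod2S (res_coh x) (res_coh y) modnMm. Qed.
Definition Z2_mul x y := MkZ2 (Z2_mul_coh x y).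

(* [x * (2 ^ k - 1)] represents [- x] modulo [2 ^ k]. *)
Lemma Z2_opp_coh (x : Z2) k :
  ((x k * (2 ^ k - 1)) %% 2 ^ k
    = ((x k.+1 * (2 ^ k.+1 - 1)) %% 2 ^ k.+1) %% 2 ^ k)%N.
Proof.
rewrite mod2S (res_coh x) modnMml -[in RHS]modnMmr -[in LHS]modnMmr.
congr ((_ * _) %% _)%N.
have -> : (2 ^ k.+1 - 1 = (2 ^ k - 1) + 2 ^ k)%N.
  by rewrite expnS mul2n -addnn addnBAC // expn_gt0.
by rewrite modnDr.
Qed.
Definition Z2_opp x := MkZ2 (Z2_opp_coh x).

Lemma Z2_addA : associative Z2_add.
Proof. by move=> x y z; apply: Z2_ext => k /=; rewrite modnDmr modnDml addnA. Qed.
Lemma Z2_addC : commutative Z2_add.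
Proof. by move=> x y; apply: Z2_ext => k /=; rewrite addnC. Qed.
Lemma Z2_add0 : left_id Z2_zero Z2_add.
Proof. by move=> x; apply: Z2_ext => k /=; rewrite add0n res_mod. Qed.
Lemma Z2_addN : left_inverse Z2_zero Z2_opp Z2_add.
Proof.
move=> x; apply: Z2_ext => k /=.
by rewrite modnDml addnC -mulnS subn1 prednK ?expn_gt0 // modnMl.
Qed.

HB.instance Definition _ :=
  GRing.isZmodule.Build Z2 Z2_addA Z2_addC Z2_add0 Z2_addN.

Lemma Z2_mulA : associative Z2_mul.
Proof. by move=> x y z; apply: Z2_ext => k /=; rewrite modnMmr modnMml mulnA. Qed.
Lemma Z2_mulC : commutative Z2_mul.
Proof. by move=> x y; apply: Z2_ext => k /=; rewrite mulnC. Qed.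
Lemma Z2_mul1 : left_id Z2_one Z2_mul.
Proof. by move=> x; apply: Z2_ext => k /=; rewrite modnMml mul1n res_mod. Qed.
Lemma Z2_mulD : left_distributive Z2_mul Z2_add.
Proof.
by move=> x y z; apply: Z2_ext => k /=; rewrite modnMml mulnDl modnDm.
Qed.
Lemma Z2_one_neq0 : Z2_one != Z2_zero.
Proof. by apply/eqP => /(congr1 (fun x : Z2 => x 1%N)). Qed.

HB.instance Definition _ := GRing.Zmodule_isComNzRing.Build Z2
  Z2_mulA Z2_mulC Z2_mul1 Z2_mulD Z2_one_neq0.

Definition Z2_unit : {pred Z2} := fun x => `[< exists y : Z2, y * x = 1 >].
Definition Z2_inv (x : Z2) : Z2 :=
  if x \in Z2_unit then xget 0 [set y : Z2 | y * x = 1] else x.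

Lemma Z2_mulVx : {in Z2_unit, left_inverse 1 Z2_inv *%R}.
Proof.
move=> x Ux; rewrite /Z2_inv Ux; move: Ux => /asboolP ex.
exact: (xgetPex _ ex).
Qed.
Lemma Z2_unitPl (x y : Z2) : y * x = 1 -> Z2_unit x.
Proof. by move=> yx; apply/asboolP; exists y. Qed.
Lemma Z2_inv_out : {in [predC Z2_unit], Z2_inv =1 id}.
Proof. by move=> x; rewrite inE /Z2_inv => /negbTE ->. Qed.

HB.instance Definition _ :=
  GRing.ComNzRing_hasMulInverse.Build Z2 Z2_mulVx Z2_unitPl Z2_inv_out.

Lemma Z2_neq0 (x : Z2) : x != 0 -> exists2 i, (x i != 0)%N & (x i < 2 ^ i)%N.
Proof.
move=> x0; have : ~ (forall k, x k = 0%N).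
  by move=> x0'; move/eqP: x0; apply; apply: Z2_ext.
move/existsNP => [i /eqP xi]; exists i => //.
by rewrite -res_mod ltn_mod expn_gt0.
Qed.

Lemma Z2_integral : GRing.integral_domain_axiom Z2.
Proof.
move=> x y xy; apply/negPn/negP; rewrite negb_or => /andP[/Z2_neq0 + /Z2_neq0].
move=> [i xi xlt] [j yj ylt].
have key (z : Z2) m k : (z m != 0)%N -> (z m < 2 ^ m)%N -> (m <= k)%N ->
    (0 < z k)%N /\ (logn 2 (z k) < m)%N.
  move=> zm zlt mk; have zk := res_leq z mk.
  have z0 : (0 < z k)%N.
    by rewrite lt0n; apply: contraNneq zm => z0; rewrite -zk z0 mod0n.
  split=> //; rewrite ltnNge -pfactor_dvdn //.
  by apply: contraNN zm; rewrite /dvdn zk.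
have [x0 lx] := key x i (i + j)%N xi xlt (leq_addr _ _).
have [y0 ly] := key y j (i + j)%N yj ylt (leq_addl _ _).
have /(congr1 (fun z : Z2 => z (i + j)%N)) /= /eqP := xy.
rewrite -/(dvdn _ _) pfactor_dvdn ?muln_gt0 ?x0 // lognM // leqNgt.
by rewrite -addnS leq_add // ltnW.
Qed.

HB.instance Definition _ := GRing.ComUnitRing_isIntegral.Build Z2 Z2_integral.

Definition Q2 := {fraction Z2}.
HB.instance Definition _ := GRing.Field.on Q2.

Definition toQ2 (t : Z2) : Q2 := FracField.tofrac t.
Definition Z2_in_Q2 : set Q2 := range toQ2.

(* The 2-adic topology on Q_2: the cosets x + 2^k Z_2 form a basis of
   neighbourhoods of x. *)
Definition Q2_coset (x : Q2) (k : nat) : set Q2 :=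
  [set x + 2 ^+ k * toQ2 t | t in [set: Z2]].
Definition Q2_open : set_system Q2 :=
  [set U | forall x, U x -> exists k, Q2_coset x k `<=` U].

Lemma Q2_coset_leq x j k : (j <= k)%N -> Q2_coset x k `<=` Q2_coset x j.
Proof.
move=> jk _ [t _ <-]; exists (2 ^+ (k - j) * t) => //.
by rewrite /toQ2 rmorphM rmorphXn rmorph_nat mulrA -exprD subnKC.
Qed.
Lemma Q2_openT : Q2_open setT.
Proof. by move=> x _; exists 0%N. Qed.
Lemma Q2_openI : setI_closed Q2_open.
Proof.
move=> A B oA oB x [/oA[j jA] /oB[k kB]]; exists (maxn j k) => y xy.
by split; [apply: jA | apply: kB]; apply: Q2_coset_leq xy;
  rewrite ?leq_maxl ?leq_maxr.
Qed.
Lemma Q2_open_bigU (I : Type) (f : I -> set Q2) :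
  (forall i, Q2_open (f i)) -> Q2_open (\bigcup_i f i).
Proof.
by move=> of_ x [i _ /of_[k fk]]; exists k => y /fk fy; exists i.
Qed.

HB.instance Definition _ :=
  isOpenTopological.Build Q2 Q2_openT Q2_openI Q2_open_bigU.
HB.instance Definition _ := isPointed.Build Q2 0.

Notation borel T := (g_sigma_algebraType (@open T)).

(* A normalized Haar measure for the addition of T: a translation-invariant
   Borel measure giving mass 1 to O (a compact open subgroup in all the uses
   below, so that mu is unique, nonzero and finite on compact sets). *)
Definition normalized_haar (R : realType) (T : zmodType) (B : set_system T)
    (O : set T) (mu : set T -> \bar R) : Prop :=
  mu O = 1%E /\ forall x A, B A -> mu [set x + y | y in A] = mu A.

Definition cintegral d (T : measurableType d) (R : realType)
    (mu : {measure set T -> \bar R}) (f : T -> R[i]) : R[i] :=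
  Complex (\int[mu]_x complex.Re (f x)) (\int[mu]_x complex.Im (f x)).

Definition is_dyadic (y : rat) : Prop :=
  exists (m : int) (k : nat), y = m%:~R / 2 ^+ k.

Definition expi (R : realType) (t : R) : R[i] := Complex (cos t) (sin t).

(* [y] is only determined modulo Z, which does not affect the value. *)
Definition e2 (R : realType) (z : Q2) : R[i] :=
  let y := get [set y : rat | is_dyadic y /\ Z2_in_Q2 (z - ratr y)] in
  expi (- (2 * pi * ratr y)).

Section Density.
Variables (V : vectType rat) (b : {dot V for idfun}) (n : nat).
Variable v : n.-tuple V.

(* V_2 = V (x) Q_2 is identified with row vectors over Q_2 through the basis
   v of V; [base_change] is the canonical embedding of V. *)
Definition V2 := 'rV[Q2]_n.
Definition base_change (u : V) : V2 := \row_i ratr (coord v i u).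
Definition L2 : set V2 := [set w | forall i, Z2_in_Q2 (w 0 i)].
Definition gram2 : 'M[Q2]_n := \matrix_(i, j) ratr (b (tnth v i) (tnth v j)).
Definition phi2 (w : V2) : Q2 := (w *m gram2 *m w^T) 0 0.
Definition X2 (nu : V) : set V2 := [set l + base_change nu | l in L2].

(* L_2 has a Z_2-basis (the rows of P) with Gram matrix diag(d_1, ..., d_n). *)
Definition L2_isom_diag (d : 'I_n -> Z2) : Prop :=
  exists2 P : 'M[Z2]_n, P \in unitmx &
    map_mx toQ2 P *m gram2 *m (map_mx toQ2 P)^T = diag_mx (\row_i toQ2 (d i)).

Definition local_density (R : realType)
    (dv : {measure set (borel V2) -> \bar R})
    (ds : {measure set (borel Q2) -> \bar R}) (h : rat) (nu : V) : R[i] :=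
  cintegral ds (fun s : Q2 =>
    cintegral dv (fun w : V2 =>
      e2 R (s * (phi2 w - ratr h)) * (real_complex R (\1_(X2 nu) w)))).

End Density.

Definition admissible (r : seq nat) : Prop :=
  exists i : nat,
    [\/ take 4 r = [:: 0; 0; 0; i]%N /\ (0 <= i <= 2)%N,
        take 4 r = [:: 0; 0; 1; i]%N /\ (1 <= i <= 3)%N,
        take 4 r = [:: 0; 1; 1; i]%N /\ (1 <= i <= 2)%N |
        take 4 r = [:: 0; 1; 2; i]%N /\ (2 <= i <= 3)%N].

(* Main.v *)
(** Since [N] is odd, [X_2 = L_2] and [h] is a 2-adic integer. Put
    [delta_k t = 2^k] if [2^k] divides [t] and [0] otherwise. In the basis of
    [L_2] with diagonal Gram matrix, the part of the integral over [sigma] in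
    [2^-k Z_2] is the mean value over [x] modulo [2^k] of
    [delta_k (h - sum_i b_i 2^(r_i) x_i^2)]. Weyl differencing bounds the inner
    integral by a multiple of [|sigma|^(-n/2)], which is integrable as
    [n >= 6], so the density is the limit of these mean values, and it is
    enough to bound them uniformly in [k].

    For the four leading variables, the vectors with an odd coordinate at a
    unit coefficient contribute an amount that depends only on the
    coefficients and on [h] modulo 8, because squaring maps the odd residues
    evenly onto the residues congruent to 1 modulo 8. In the remaining vectors
    the unit variables are even; halving the equation replaces each exponent 0
    by 1 and each exponent [r > 0] by [r - 1]. The admissible patterns generate
    a finite set of patterns under this move, and checking it residue by
    residue gives the upper bound 2 and a lower bound depending only on the
    2-adic valuation of [h]. Averaging over a fifth variable keeps the argument
    of the quaternary form at bounded valuation and makes the lower bound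
    uniform. *)

Require Import Defs.
From HB Require Import structures.
From mathcomp Require Import all_boot all_order all_algebra.
From mathcomp Require Import fraction sesquilinear complex.
From mathcomp Require Import all_classical all_reals all_analysis.
From mathcomp Require Import measurable_realfun.
From mathcomp Require Import zify ring lra.

Set Implicit Arguments.
Unset Strict Implicit.
Unset Printing Implicit Defensive.

Import Order.TTheory GRing.Theory Num.Theory.
Import numFieldNormedType.Exports.
Local Open Scope classical_set_scope.
Local Open Scope ring_scope.

(** * Averages over squares *)

Section Averages.
Variable C : numFieldType.
Implicit Types (g : int -> C) (s : seq int) (t d : int).

(** Convolution of [g] with the uniform distribution on [s]; such convolutions commute, so the
    variables of a diagonal form may be averaged in any order. *)
Definition avg s g t : C := (size s)%:R^-1 * \sum_(z <- s) g (t - z).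

Lemma avgC s s' g : avg s (avg s' g) = avg s' (avg s g).
Proof.
apply: funext => t; rewrite /avg -!big_distrr /= mulrCA; congr (_ * (_ * _)).
rewrite exchange_big /=; apply: eq_bigr => z _; apply: eq_bigr => z' _.
by rewrite addrAC.
Qed.

Lemma avg_lin s (a : C) g g' :
  avg s (fun t => g t + a * g' t) = fun t => avg s g t + a * avg s g' t.
Proof.
apply: funext => t.
by rewrite /avg big_split /= mulrDr -big_distrr /= mulrCA.
Qed.

Lemma avgZ s (a : C) g : avg s (fun t => a * g t) = fun t => a * avg s g t.
Proof. by apply: funext => t; rewrite /avg -big_distrr /= mulrCA. Qed.

Lemma avg_cst s g t (c : C) : (0 < size s)%N ->
  (forall z, z \in s -> g (t - z) = c) -> avg s g t = c.
Proof.
move=> s0 gc; rewrite /avg (eq_big_seq (fun=> c)) // big_const_seq count_predT.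
by rewrite iter_addr_0 -[c *+ _]mulr_natl mulKf // pnatr_eq0 -lt0n.
Qed.

Lemma avg_le s g g' t : (forall t, g t <= g' t) -> avg s g t <= avg s g' t.
Proof. by move=> gg'; rewrite ler_wpM2l ?invr_ge0 // ler_sum. Qed.

Lemma avg_ge0 s g t : (forall t, 0 <= g t) -> 0 <= avg s g t.
Proof. by move=> g0; rewrite mulr_ge0 ?invr_ge0 // sumr_ge0. Qed.

Definition squares d m : seq int := [seq d * x%:Z ^+ 2 | x <- iota 0 (2 ^ m)].
(** Here [x.*2.+1] exhausts the odd residues modulo [2 ^ m.+1], one bit more than the index [m]. *)
Definition odd_squares d m : seq int :=
  [seq d * (x.*2.+1)%:Z ^+ 2 | x <- iota 0 (2 ^ m)].

Lemma size_squares d m : size (squares d m) = (2 ^ m)%N.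
Proof. by rewrite size_map size_iota. Qed.

Lemma size_odd_squares d m : size (odd_squares d m) = (2 ^ m)%N.
Proof. by rewrite size_map size_iota. Qed.

Lemma avg_squaresE d m g t :
  avg (squares d m) g t
  = (2 ^ m)%:R^-1 * \sum_(0 <= x < 2 ^ m) g (t - d * x%:Z ^+ 2).
Proof. by rewrite /avg size_squares big_map /index_iota subn0. Qed.

Lemma avg_odd_squaresE d m g t :
  avg (odd_squares d m) g t
  = (2 ^ m)%:R^-1 * \sum_(0 <= x < 2 ^ m) g (t - d * (x.*2.+1)%:Z ^+ 2).
Proof. by rewrite /avg size_odd_squares big_map /index_iota subn0. Qed.

Lemma sum_double (f : nat -> C) M :
  \sum_(0 <= x < M.*2) f x
  = \sum_(0 <= x < M) f x.*2 + \sum_(0 <= x < M) f x.*2.+1.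
Proof.
elim: M => [|M IH]; first by rewrite !big_geq // addr0.
by rewrite doubleS !(@big_nat_recr _ _ _ _ 0%N) //= IH; ring.
Qed.

Lemma avg_squares_split d m g t :
  avg (squares d m.+1) g t
  = 2^-1 * avg (squares (4 * d) m) g t + 2^-1 * avg (odd_squares d m) g t.
Proof.
rewrite !avg_squaresE avg_odd_squaresE expnS mul2n sum_double -mul2n natrM.
rewrite invfM -!mulrA -!mulrDr; congr (_ * (_ * (_ + _))).
by apply: eq_bigr => x _; congr (g _); rewrite -muln2 PoszM; ring.
Qed.

Lemma sum_shift (f : nat -> C) M c : (forall x, f (x + M)%N = f x) ->
  \sum_(0 <= x < M) f (x + c)%N = \sum_(0 <= x < M) f x.
Proof.
move=> fM; elim: c => [|c IH]; first by under eq_bigr do rewrite addn0.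
rewrite -IH; case: M fM {IH} => [|M] fM; first by rewrite !big_geq.
rewrite big_nat_recr //= [RHS]big_nat_recl //= addrC; congr (_ + _).
  by rewrite add0n -(fM c); congr f; lia.
by apply: eq_bigr => x _; congr f; lia.
Qed.

(** The normalised point mass at 0 in Z/2^k: its mean over all vectors modulo 2^k is the number of
    solutions divided by 2^(k(n-1)). *)
Definition delta (k : nat) t : C := if (2 ^+ k %| t)%Z then 2 ^+ k else 0.

Lemma delta_ge0 k t : 0 <= delta k t.
Proof. by rewrite /delta; case: ifP => // _; rewrite exprn_ge0. Qed.

Lemma delta_dvd k t z : (2 ^+ k %| z)%Z -> delta k (t + z) = delta k t.
Proof. by move=> kz; rewrite /delta rpredDr. Qed.

Lemma delta_double k t : delta k.+1 (2 * t) = 2 * delta k t.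
Proof.
rewrite /delta exprS dvdz_mul2l //; case: ifP => _; last by rewrite mulr0.
by rewrite exprS.
Qed.

Lemma delta_odd k t : (0 < k)%N -> ~~ (2 %| t)%Z -> delta k t = 0.
Proof.
move=> k0 t2; rewrite /delta; case: ifP => // kt; case/negP: t2.
by apply: dvdz_trans kt; rewrite -(prednK k0) exprS dvdz_mulr.
Qed.

(** A residue modulo 2^k has two lifts modulo 2^(k+1); the point mass at level [k] is the mean of
    the next one over these lifts. *)
Lemma delta_split k t : delta k.+1 t + delta k.+1 (t + 2 ^+ k) = 2 * delta k t.
Proof.
case kt : (2 ^+ k %| t)%Z; last first.
  have h z : (2 ^+ k %| z)%Z = false -> delta k.+1 z = 0.
    rewrite /delta => kz; case: ifP => // /dvdzP[q zq]; move: kz.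
    by rewrite zq exprS mulrA dvdz_mull.
  by rewrite !h ?addr0 ?rpredDr // /delta kt mulr0.
have /dvdzP[q ->] := kt; rewrite [in RHS]/delta dvdz_mull // -exprS.
have -> : q * 2 ^+ k + 2 ^+ k = (q + 1) * 2 ^+ k by ring.
have p0 : (2 ^+ k : int) != 0 by rewrite expf_neq0.
rewrite /delta exprS !dvdz_mul2r //.
have -> : (2 %| q + 1)%Z = ~~ (2 %| q)%Z by lia.
by case: (2 %| q)%Z; rewrite /= ?addr0 ?add0r.
Qed.

(* Squaring maps the odd residues onto the residues congruent to 1 modulo 8,
   four to one: moving [x] by [2 ^ (k-1)] moves [x ^ 2] by [2 ^ k] modulo
   [2 ^ (k+1)], so the count is the same at every level [k >= 3]. *)
Lemma avg_odd_squares_delta d m k t : ~~ (2 %| d)%Z -> (3 <= k <= m.+1)%N ->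
  avg (odd_squares d m) (delta k) t = delta 3 (t - d).
Proof.
move=> d2 /andP[k3]; elim: k k3 => // k IH; rewrite leq_eqVlt => /orP[/eqP<-|].
  (* Base level 3: odd squares are 1 modulo 8, so all terms of the average agree. *)
  move=> _; apply: avg_cst; first by rewrite size_odd_squares expn_gt0.
  move=> z /mapP[x _ ->].
  have /dvdzP[q hq] : (2 ^+ 3 %| (x.*2.+1)%:Z ^+ 2 - 1)%Z.
    have -> : (x.*2.+1)%:Z ^+ 2 - 1 = 4 * (x%:Z * (x%:Z + 1)).
      have -> : (x.*2.+1)%:Z = 2 * x%:Z + 1 by lia.
      ring.
    rewrite (_ : 2 ^+ 3 = 4 * 2 :> int) // dvdz_mul2l //.
    have : (2 %| x%:Z)%Z \/ (2 %| x%:Z + 1)%Z by lia.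
    by case=> h; [apply: dvdz_mulr | apply: dvdz_mull].
  rewrite -[RHS](delta_dvd _ (z := - d * (q * 2 ^+ 3)));
    last exact/dvdz_mull/dvdz_mull/dvdzz.
  by congr delta; rewrite -hq; ring.
rewrite ltnS => k3 km; rewrite -(IH k3 (ltnW km)).
have shift : avg (odd_squares d m) (delta k.+1) (t + 2 ^+ k)
           = avg (odd_squares d m) (delta k.+1) t.
  rewrite !avg_odd_squaresE; congr (_ * _).
  pose f x := delta k.+1 (t + 2 ^+ k - d * (x.*2.+1)%:Z ^+ 2).
  (* Moving [x] by 2^(k-2) moves the odd number [x.*2.+1] by 2^(k-1). *)
  rewrite -(@sum_shift f (2 ^ m) (2 ^ (k - 2))) => [|x]; last first.
    rewrite /f -[LHS](delta_dvd _ (z :=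
      d * (2 ^+ m.+1 * (2 * (x.*2.+1)%:Z + 2 ^+ m.+1)))).
      congr delta; have -> : ((x + 2 ^ m).*2.+1)%:Z = (x.*2.+1)%:Z + 2 ^+ m.+1.
        by rewrite exprS -rmorphXn /=; lia.
      by ring.
    apply/dvdz_mull/dvdz_mulr; rewrite -(subnKC km) exprD dvdz_mulr //.
  apply: eq_bigr => x _; rewrite /f.
  (* The square of the shift is 2^(2k-2) = 2^(k+1) 2^j, and the cross term is 2^k times the odd
     number 2e + 1. Modulo 2^(k+1) only 2^k survives, and it cancels the 2^k added to [t]. *)
  have [j hj] : exists j, k = j.+3 by exists (k - 3)%N; lia.
  have /dvdzP[e he] : (2 %| d * (x.*2.+1)%:Z - 1)%Z by lia.
  rewrite -[RHS](delta_dvd _ (z := - (2 ^+ k.+1 * e) - d * 2 ^+ k.+1 * 2 ^+ j)).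
    have -> : ((x + 2 ^ (k - 2)).*2.+1)%:Z = (x.*2.+1)%:Z + 2 ^+ (k.-1).
      rewrite hj /= exprS -rmorphXn /=; have -> : (j.+3 - 2 = j.+1)%N by lia.
      lia.
    congr delta; have e2 : 2 * e = d * (x.*2.+1)%:Z - 1 by rewrite he; ring.
    transitivity (t + 2 ^+ k - d * (x.*2.+1)%:Z ^+ 2 -
      (2 ^+ k * (d * (x.*2.+1)%:Z) + d * (2 ^+ k.-1 * 2 ^+ k.-1))).
      by rewrite hj /= !exprS; ring.
    have -> : d * (x.*2.+1)%:Z = 2 * e + 1 by rewrite e2; ring.
    by rewrite hj /= !exprS; ring.
  apply: rpredB; first by rewrite rpredN; exact/dvdz_mulr/dvdzz.
  exact/dvdz_mulr/dvdz_mull/dvdzz.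
have e : avg (odd_squares d m) (fun t => delta k.+1 (t + 2 ^+ k)) t
       = avg (odd_squares d m) (delta k.+1) t.
  rewrite -shift /avg; congr (_ * _); apply: eq_bigr => z _.
  by congr delta; ring.
have c2 : (2 : C) != 0 by rewrite pnatr_eq0.
(* By [shift], twice the average at level k+1 is the average over both lifts, which [delta_split]
   brings down to level [k]. *)
apply: (mulfI c2).
transitivity (avg (odd_squares d m) (fun t => 2 * delta k t) t); last first.
  by rewrite avgZ.
rewrite mulr_natl mulr2n -{2}e -[X in _ + X]mul1r.
have /(congr1 (fun f => f t)) <- := avg_lin (odd_squares d m) 1 (delta k.+1)
  (fun t => delta k.+1 (t + 2 ^+ k)).
by congr avg; apply: funext => z; rewrite mul1r delta_split.
Qed.

End Averages.

(* [(b, r, m)] stands for the term [b * 2 ^ r * x ^ 2] with [x] ranging over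
   the residues modulo [2 ^ m]. *)
Definition item := (int * nat * nat)%type.
Definition coef (it : item) : int := it.1.1 * 2 ^+ it.1.2.
(** Twice the new coefficient is the old one, or, for exponent 0, the coefficient after substituting
    2x for x; that substitution uses up one bit of the range of x. *)
Definition next_item (it : item) : item :=
  if it.1.2 is r.+1 then (it.1.1, r, it.2) else (it.1.1, 1%N, it.2.-1).
Definition proper_item (k : nat) (it : item) : bool :=
  ~~ (2 %| it.1.1)%Z && (k <= it.2)%N.

Lemma proper_next k it : proper_item k it -> proper_item k.-1 (next_item it).
Proof.
case: it => [[b [|r]] m] /andP[/= b2 km]; rewrite /proper_item b2 /=; lia.
Qed.

(** * Recursion on the level by halving the equation *)

Section Densities.
Variable C : numFieldType.
Implicit Types (g : int -> C) (its : seq item).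

Definition dens its g := foldr (fun it => avg (squares (coef it) it.2)) g its.
(* The contribution of the even values of [x] if the coefficient is odd, and of
   all values of [x] otherwise. *)
Definition even_avg (it : item) g (t : int) : C :=
  2^-1 ^+ (it.1.2 == 0)%N
  * avg (squares (2 * coef (next_item it)) (next_item it).2) g t.
Definition even_dens its g := foldr even_avg g its.

Lemma dens_cat its its' g : dens (its ++ its') g = dens its (dens its' g).
Proof. exact: foldr_cat. Qed.

Lemma avg_dens s its g : avg s (dens its g) = dens its (avg s g).
Proof. by elim: its => //= it its IH; rewrite avgC IH. Qed.

Lemma densC its its' g : dens its (dens its' g) = dens its' (dens its g).
Proof. by elim: its => //= it its ->; rewrite avg_dens. Qed.

Lemma avgB s g g' t : avg s g t - avg s g' t = avg s (fun t => g t - g' t) t.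
Proof.
have /(congr1 (fun f => f t)) := avg_lin s (-1) g g'.
rewrite mulN1r => <-; congr avg; apply: funext => z; by rewrite mulN1r.
Qed.

(** The difference is the share of the vectors with an odd variable at some unit coefficient. One
    such variable alone already reduces the point mass from level [k] to level 3. *)
Lemma dens_sub_even its k t : (3 <= k)%N -> all (proper_item k) its ->
  dens its (delta C k) t - even_dens its (delta C k) t
  = dens its (delta C 3) t - even_dens its (delta C 3) t.
Proof.
move=> k3; elim: its t => [t _|[[b r] m] its IH t]; first by rewrite /= !subrr.
rewrite /= => /andP[/andP[/= b2 km] pits].
case: r => [|r]; last first.
  rewrite /even_avg /= !mul1r /coef /= mulrCA -exprS !avgB.
  by congr avg; apply: funext => z; rewrite IH.
case: m km => [|m] km; first by lia.
rewrite /even_avg /coef /= !expr1 mulr1 (_ : 2 * (b * 2) = 4 * b); last by ring.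
rewrite !avg_squares_split ![_ + _ - _]addrAC -![2^-1 * _ - _]mulrBr !avgB.
congr (_ * _ + _ * _).
  by congr avg; apply: funext => z; rewrite IH.
(* The odd half of the variable is moved innermost, where it meets the point mass directly. *)
rewrite !avg_dens; congr dens; apply: funext => z.
by rewrite !avg_odd_squares_delta //; lia.
Qed.

Lemma avg_squares_double c m g t :
  avg (squares (2 * c) m) g (2 * t) = avg (squares c m) (fun t => g (2 * t)) t.
Proof.
rewrite !avg_squaresE; congr (_ * _); apply: eq_bigr => x _.
by congr g; ring.
Qed.

Lemma even_dens_double its g t :
  even_dens its g (2 * t) = 2^-1 ^+ (count (pred1 0%N) [seq it.1.2 | it <- its])
    * dens [seq next_item it | it <- its] (fun t => g (2 * t)) t.
Proof.
elim: its t => [|it its IH] t; first by rewrite /= mul1r.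
rewrite [LHS]/= /even_avg avg_squares_double /= exprD -mulrA; congr (_ * _).
have /(congr1 (fun f => f t)) <- := avgZ
  (squares (coef (next_item it)) (next_item it).2)
  (2^-1 ^+ (count (pred1 0%N) [seq it.1.2 | it <- its]))
  (dens [seq next_item it | it <- its] (fun t => g (2 * t))).
by congr avg; apply: funext => z; rewrite IH.
Qed.

(** All coefficients left in [even_dens] are even, so an odd argument stays odd. *)
Lemma even_dens_odd its g : (forall t, ~~ (2 %| t)%Z -> g t = 0) ->
  forall t, ~~ (2 %| t)%Z -> even_dens its g t = 0.
Proof.
move=> g0; elim: its => //= it its IH t t2.
rewrite /even_avg (@avg_cst _ _ _ _ 0) ?mulr0 ?size_squares ?expn_gt0 //.
move=> z /mapP[x _ ->]; apply: IH; rewrite -mulrA rpredBr //.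
exact/dvdz_mulr/dvdzz.
Qed.

Lemma dens_rec its k t : (2 <= k)%N -> all (proper_item k.+1) its ->
  dens its (delta C k.+1) t
  = dens its (delta C 3) t - even_dens its (delta C 3) t
    + if (2 %| t)%Z
      then 2 * 2^-1 ^+ (count (pred1 0%N) [seq it.1.2 | it <- its])
           * dens [seq next_item it | it <- its] (delta C k) (t %/ 2)%Z
      else 0.
Proof.
move=> k2 pits; rewrite -(@dens_sub_even its k.+1) // -addrA; case: ifP => t2.
  rewrite -{3}(divzK t2) [(_ %/ _)%Z * 2]mulrC even_dens_double.
  set u := 2^-1 ^+ _; rewrite (_ : (fun _ => _) = fun t => 2 * delta C k t).
    suff -> : dens [seq next_item it | it <- its] (fun t => 2 * delta C k t)
      = fun t => 2 * dens [seq next_item it | it <- its] (delta C k) t.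
      by ring.
    by elim: (map _ _) => //= it its' ->; rewrite avgZ.
  by apply: funext => z; rewrite delta_double.
rewrite even_dens_odd ?t2 ?oppr0 ?addr0 // => z; exact: delta_odd.
Qed.

Lemma dens_ge0 its g : (forall t, 0 <= g t) -> forall t, 0 <= dens its g t.
Proof. by move=> g0; elim: its => //= it its IH t; apply: avg_ge0. Qed.

Lemma dens_le_cst its g (c : C) : (forall t, g t <= c) ->
  forall t, dens its g t <= c.
Proof.
move=> gc; elim: its => //= it its IH t.
have <- : avg (squares (coef it) it.2) (fun=> c) t = c.
  by apply: avg_cst => //; rewrite size_squares expn_gt0.
exact: avg_le.
Qed.

(* A function of period 8 is stored as a multiple [a] of the table [G] of its
   values at 0, ..., 7. *)
Definition mod8 (t : int) : nat := `|(t %% 8)%Z|%N.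
Definition tabulated (a : C) g (G : seq nat) :=
  forall t, g t = a * (nth 0%N G (mod8 t))%:R.
(** Four times one average: modulo 8 a square is 0, 4 or 1 with frequencies 1/4, 1/4, 1/2, and
    adding [4 * d] or [7 * d] stands for subtracting 4d or d. The flag [e] drops the odd values of
    x. *)
Definition table_step (e : bool) (d : nat) (G : seq nat) : seq nat :=
  [seq (nth 0 G t + nth 0 G ((t + 4 * d) %% 8)
        + if e then 0 else 2 * nth 0 G ((t + 7 * d) %% 8))%N | t <- iota 0 8].
Definition table_delta (q : nat) : seq nat :=
  [seq ((t %% q)%N == 0%N : nat) | t <- iota 0 8].
Definition table_dens (e : bool) (q : nat) (rs ds : seq nat) : seq nat :=
  foldr (fun p => table_step (e && (p.1 == 0%N)) p.2) (table_delta q)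
    (zip rs ds).

Lemma mod8_lt t : (mod8 t < 8)%N. Proof. rewrite /mod8; lia. Qed.

Lemma mod8_sub t d : mod8 (t - d) = ((mod8 t + 7 * mod8 d) %% 8)%N.
Proof. rewrite /mod8; lia. Qed.

Lemma nth_table e d G t : nth 0%N (table_step e d G) (mod8 t)
  = (nth 0 G (mod8 t) + nth 0 G ((mod8 t + 4 * d) %% 8)
     + if e then 0 else 2 * nth 0 G ((mod8 t + 7 * d) %% 8))%N.
Proof. by rewrite (nth_map 0%N) ?nth_iota ?size_iota ?mod8_lt. Qed.

Lemma tabulated_mod a g G t t' :
  tabulated a g G -> (8 %| t - t')%Z -> g t = g t'.
Proof.
by move=> tg tt; rewrite !tg (_ : mod8 t = mod8 t') //; rewrite /mod8; lia.
Qed.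

Lemma avg4_tabulated a g G d m t : tabulated a g G ->
  avg (squares (4 * d) m.+1) g t = 2^-1 * (g t + g (t - 4 * d)).
Proof.
move=> tg; rewrite avg_squares_split mulrDr; congr (_ * _ + _ * _);
  (apply: avg_cst; first by rewrite size_map size_iota expn_gt0);
  move=> z /mapP[x _ ->]; apply: (tabulated_mod tg).
  by apply/dvdzP; exists (- 2 * d * x%:Z ^+ 2); ring.
have -> : (x.*2.+1)%:Z = 2 * x%:Z + 1 by lia.
by apply/dvdzP; exists (- d * (2 * x%:Z ^+ 2 + 2 * x%:Z)); ring.
Qed.

Lemma avg_tabulated a g G d m t : tabulated a g G ->
  avg (squares d m.+2) g t
  = 4^-1 * (g t + g (t - 4 * d) + 2 * g (t - d)).
Proof.
move=> tg; rewrite avg_squares_split (avg4_tabulated _ _ _ tg).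
rewrite (_ : avg (odd_squares d _) _ _ = g (t - d)).
  by field.
apply: avg_cst; first by rewrite size_map size_iota expn_gt0.
move=> z /mapP[x _ ->]; apply: (tabulated_mod tg).
have -> : (x.*2.+1)%:Z = 2 * x%:Z + 1 by lia.
have /dvdzP[q hq] : (2 %| x%:Z ^+ 2 + x%:Z)%Z.
  have -> : x%:Z ^+ 2 + x%:Z = x%:Z * (x%:Z + 1) by ring.
  have : (2 %| x%:Z)%Z \/ (2 %| x%:Z + 1)%Z by lia.
  by case=> h; [apply: dvdz_mulr | apply: dvdz_mull].
apply/dvdzP; exists (- d * q).
transitivity (- d * (4 * (x%:Z ^+ 2 + x%:Z))); [by ring|by rewrite hq; ring].
Qed.

Lemma tabulated_sub4 a g G d t : tabulated a g G ->
  g (t - 4 * d) = a * (nth 0%N G ((mod8 t + 4 * mod8 d) %% 8))%:R.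
Proof. by move=> ->; congr (_ * (nth _ _ _)%:R); rewrite /mod8; lia. Qed.

Lemma tabulated_avg a g G d m : tabulated a g G -> (2 <= m)%N ->
  tabulated (a / 4) (avg (squares d m) g) (table_step false (mod8 d) G).
Proof.
move=> tg; case: m => [|[|m]] // _ t.
rewrite (avg_tabulated _ _ _ tg) (tabulated_sub4 _ _ tg) nth_table /= !natrD.
by rewrite !tg mod8_sub; field.
Qed.

Lemma tabulated_even a g G it : tabulated a g G -> (2 <= it.2)%N ->
  tabulated (a / 4) (even_avg it g)
    (table_step (it.1.2 == 0)%N (mod8 (coef it)) G).
Proof.
case: it => [[b [|r]] m] tg /= m2 t; rewrite /even_avg /=; last first.
  rewrite /coef /= mul1r mulrCA -exprS.
  exact: (tabulated_avg _ tg).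
case: m m2 => [|[|m]] // _; rewrite /coef /= !expr1 mulr1.
rewrite (_ : 2 * (b * 2) = 4 * b); last by ring.
rewrite (avg4_tabulated _ _ _ tg) (tabulated_sub4 _ _ tg) nth_table /= !natrD.
by rewrite tg; field.
Qed.

Lemma tabulated_delta k : (k <= 3)%N ->
  tabulated (2 ^+ k) (delta C k) (table_delta (2 ^ k)).
Proof.
move=> k3 t; rewrite (nth_map 0%N) ?nth_iota ?size_iota ?mod8_lt // add0n.
rewrite /delta (_ : (2 ^+ k %| t)%Z = ((mod8 t) %% 2 ^ k == 0)%N).
  by case: eqP; rewrite ?mulr1 ?mulr0.
by case: k k3 => [|[|[|[|]]]] // _; rewrite /mod8 /=; lia.
Qed.

Lemma tabulated_dens its k : (k <= 3)%N -> all (fun it => 2 <= it.2)%N its ->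
  tabulated (2 ^+ k / 4 ^+ size its) (dens its (delta C k))
    (table_dens false (2 ^ k) [seq it.1.2 | it <- its]
       [seq mod8 (coef it) | it <- its]).
Proof.
move=> k3; elim: its => [_|it its IH /= /andP[m2 /IH tits]].
  by rewrite divr1; apply: tabulated_delta.
rewrite exprSr invfM mulrA; exact: (tabulated_avg _ tits).
Qed.

Lemma tabulated_even_dens its k : (k <= 3)%N ->
  all (fun it => 2 <= it.2)%N its ->
  tabulated (2 ^+ k / 4 ^+ size its) (even_dens its (delta C k))
    (table_dens true (2 ^ k) [seq it.1.2 | it <- its]
       [seq mod8 (coef it) | it <- its]).
Proof.
move=> k3; elim: its => [_|it its IH /= /andP[m2 /IH tits]].
  by rewrite divr1; apply: tabulated_delta.
rewrite exprSr invfM mulrA; exact: (tabulated_even tits).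
Qed.

End Densities.

(** * Finite check of the exponent patterns *)

Definition residues (r : nat) : seq nat :=
  nth [::] [:: [:: 1; 3; 5; 7]; [:: 2; 6]; [:: 4]; [:: 0]]%N r.
Definition residue_lists (rs : seq nat) : seq (seq nat) :=
  foldr (fun r dss => [seq d :: ds | d <- residues r, ds <- dss]) [:: [::]] rs.
Definition next_exp (r : nat) : nat := if r is r'.+1 then r' else 1%N.

(* The exponent patterns obtained from the admissible ones by iterating
   [next_exp] on every entry. *)
Definition patterns : seq (seq nat) :=
  [:: [:: 0; 0; 0; 0]; [:: 1; 1; 1; 1]; [:: 0; 0; 0; 1]; [:: 1; 1; 1; 0];
      [:: 0; 0; 0; 2]; [:: 0; 0; 1; 1]; [:: 1; 1; 0; 0]; [:: 0; 0; 1; 2];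
      [:: 1; 1; 0; 1]; [:: 0; 0; 1; 0]; [:: 0; 0; 1; 3]; [:: 1; 1; 0; 2];
      [:: 0; 1; 1; 1]; [:: 1; 0; 0; 0]; [:: 0; 1; 1; 2]; [:: 1; 0; 0; 1];
      [:: 0; 1; 1; 0]; [:: 0; 1; 2; 2]; [:: 1; 0; 1; 1]; [:: 0; 1; 0; 0];
      [:: 0; 1; 2; 3]; [:: 1; 0; 1; 2]; [:: 0; 1; 0; 1]; [:: 1; 0; 1; 0]]%N.
Definition nonprimitive (rs : seq nat) : bool := rs == [:: 1; 1; 1; 1]%N.
(* Only the form with all exponents 1 takes no odd value. *)
Definition upper_bound (rs : seq nat) (o : bool) : nat :=
  if nonprimitive rs then if o then 0%N else 4%N else 2%N.

(* [w], [e] are the tables of [dens] and [even_dens] modulo 8, in units of 1/32,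
   and [w2] is the table of [dens] modulo 4, in units of 1/64. *)
Definition check_residue (rs : seq nat) (w e w2 : seq nat) (t : nat) : bool :=
  let rs' := map next_exp rs in let u := count (pred1 0%N) rs in
  [&& (nth 0 w t + (if odd t then 0
                    else 2 ^ (6 - u) * upper_bound rs' (odd t./2))
       <= 32 * upper_bound rs (odd t) + nth 0 e t)%N,
      (nth 0 w2 t <= 64 * upper_bound rs (odd t))%N,
      (nth 0 e t <= nth 0 w t)%N &
      [|| nonprimitive rs && odd t, (nth 0 e t < nth 0 w t)%N
        | ~~ odd t && ~~ (nonprimitive rs' && odd t./2)]].

Definition check_pattern (rs : seq nat) : bool :=
  [&& size rs == 4%N, all (fun r => r <= 3)%N rs, map next_exp rs \in patterns &
    all (fun ds => all (check_residue rs (table_dens false 8 rs ds)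
                          (table_dens true 8 rs ds) (table_dens false 4 rs ds))
                       (iota 0 8))
      (residue_lists rs)].

(** The tables see coefficients only modulo 8, so each pattern leaves finitely many cases. The test
    also confirms that the list is closed under [next_exp], which the inductions on the level rely
    on. *)
Lemma check_patterns : all check_pattern patterns.
Proof. by vm_compute. Qed.

Lemma mod8_coef it : ~~ (2 %| it.1.1)%Z -> (it.1.2 <= 3)%N ->
  mod8 (coef it) \in residues it.1.2.
Proof.
case: it => [[b r] m] /= b2 r3; rewrite /coef /=.
have : (mod8 b < 8)%N by exact: mod8_lt.
have : odd (mod8 b) by rewrite /mod8; lia.
have -> : mod8 (b * 2 ^+ r) = ((mod8 b * 2 ^ r) %% 8)%N.
  by case: r r3 => [|[|[|[|]]]] // _; rewrite /mod8; lia.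
by case: r r3 => [|[|[|[|]]]] // _; case: (mod8 b) => [|[|[|[|[|[|[|[|]]]]]]]].
Qed.

Lemma mem_residue_lists its : all (fun it => ~~ (2 %| it.1.1)%Z) its ->
  all (fun r => r <= 3)%N [seq it.1.2 | it <- its] ->
  [seq mod8 (coef it) | it <- its] \in residue_lists [seq it.1.2 | it <- its].
Proof.
elim: its => //= it its IH /andP[b2 bits] /andP[r3 rits].
by apply: allpairs_f; [apply: mod8_coef | apply: IH].
Qed.

(** * Bounds for the averages, uniform in the level *)

Section Bounds.
Variable R : realFieldType.
Implicit Types (its : seq item) (t : int).
Local Notation exps its := [seq it.1.2 | it <- its].
Local Notation coefs its := [seq mod8 (coef it) | it <- its].
Local Notation delta := (delta R).

Lemma check_items its t k : all (proper_item k) its -> exps its \in patterns ->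
  [/\ size its = 4%N,
      exps (map next_item its) = map next_exp (exps its),
      map next_exp (exps its) \in patterns,
      (count (pred1 0%N) (exps its) <= 4)%N &
      check_residue (exps its) (table_dens false 8 (exps its) (coefs its))
        (table_dens true 8 (exps its) (coefs its))
        (table_dens false 4 (exps its) (coefs its)) (mod8 t)].
Proof.
move=> pits /(allP check_patterns)/and4P[/eqP s4 r3 nexts /allP cds].
split=> //.
- by move: s4; rewrite size_map.
- by rewrite -!map_comp; apply: eq_map => -[[b [|r]] m].
- by rewrite -s4 count_size.
have bits : all (fun it : item => ~~ (2 %| it.1.1)%Z) its.
  by apply: sub_all pits => it /andP[].
have /allP := cds _ (mem_residue_lists bits r3); apply.
by rewrite mem_iota mod8_lt.
Qed.

Lemma odd_mod8 t : odd (mod8 t) = ~~ (2 %| t)%Z.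
Proof. rewrite /mod8; lia. Qed.

Lemma odd_mod8_half t : (2 %| t)%Z -> odd (mod8 t)./2 = ~~ (2 %| t %/ 2)%Z.
Proof. rewrite /mod8; lia. Qed.

Lemma proper_ge k its : (2 <= k)%N -> all (proper_item k) its ->
  all (fun it : item => 2 <= it.2)%N its.
Proof. by move=> k2; apply: sub_all => it /andP[_]; apply: leq_trans. Qed.

Lemma proper_nexts k its : all (proper_item k.+1) its ->
  all (proper_item k) [seq next_item it | it <- its].
Proof. by rewrite all_map; apply: sub_all => it /proper_next. Qed.

Lemma smooth_part its k t : (2 <= k)%N -> all (proper_item k) its ->
  size its = 4%N ->
  dens its (delta 3) t - even_dens its (delta 3) t
  = 32^-1 * (nth 0%N (table_dens false 8 (exps its) (coefs its)) (mod8 t))%:R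
    - 32^-1 * (nth 0%N (table_dens true 8 (exps its) (coefs its)) (mod8 t))%:R.
Proof.
move=> k2 pits s4; have m2 := proper_ge k2 pits.
rewrite (tabulated_dens R (leqnn 3) m2) (tabulated_even_dens R (leqnn 3) m2) s4.
have -> : 2 ^+ 3 / 4 ^+ 4 = 32^-1 :> R by field.
by [].
Qed.

(** Induction on the level, starting from the tables modulo 4. In the step, the checked inequality
    bounds the level 3 share plus the bound already known for the halved pattern. *)
Lemma dens_upper its k t : (2 <= k)%N -> all (proper_item k) its ->
  exps its \in patterns ->
  dens its (delta k) t <= (upper_bound (exps its) (~~ (2 %| t)%Z))%:R.
Proof.
elim: k its t => // k IH its t; rewrite leq_eqVlt => /orP[/eqP[<-]|].
  move=> pits pat; have [s4 _ _ _ /and4P[_ + _ _]] := check_items t pits pat.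
  rewrite odd_mod8 (tabulated_dens R (isT : (2 <= 3)%N)); last first.
    exact: proper_ge pits.
  by rewrite s4 -(ler_nat R) natrM; lra.
rewrite ltnS => k2 pits pat.
have [s4 nexts pat' u4 /and4P[+ _ _ _]] := check_items t pits pat.
rewrite odd_mod8 (dens_rec R t k2 pits) (smooth_part t (leqW k2) pits s4).
rewrite -(ler_nat R) [leLHS]natrD [leRHS]natrD natrM.
case: (boolP (2 %| t)%Z) => t2; rewrite /= ?natrM; last by lra.
rewrite (odd_mod8_half t2).
have := IH [seq next_item it | it <- its] (t %/ 2)%Z k2 (proper_nexts pits).
rewrite nexts => /(_ pat').
move: (dens _ _ _) (upper_bound _ _)%:R (upper_bound _ _)%:R => D B B'.
(* [2 ^ (6 - u)] is the factor 2 * 2^-u of [dens_rec] in units of 1/32. *)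
set u := count _ _ in u4 *; have -> : (2 ^ (6 - u))%:R = 64 * 2^-1 ^+ u :> R.
  have -> : 64 = 2 ^+ (6 - u) * 2 ^+ u :> R by rewrite -exprD subnK; [ring|lia].
  by rewrite natrX exprVn mulfK // expf_neq0 // pnatr_eq0.
have : 0 <= 2^-1 ^+ u :> R by rewrite exprn_ge0 // invr_ge0.
by nra.
Qed.

(** Either the level 3 share is positive, hence at least 1/32 as the table entries are integers, or
    [t] is even and the halved problem is again good. Fewer than [j] halvings are possible; the side
    condition excludes odd values of a form with all exponents 1. *)
Lemma dens_lower its j k t : (j.+2 <= k)%N -> all (proper_item k) its ->
  exps its \in patterns -> ~~ (nonprimitive (exps its) && ~~ (2 %| t)%Z) ->
  ~~ (2 ^+ j %| t)%Z -> 32^-1 ^+ j <= dens its (delta k) t.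
Proof.
elim: j k its t => [|j IH] k its t; first by rewrite dvd1z.
case: k => // k jk pits pat good tj; have k2 : (2 <= k)%N by lia.
have [s4 nexts pat' u4 /and4P[_ _ ew]] := check_items t pits pat.
rewrite odd_mod8 (negPf good) /= (dens_rec R t k2 pits).
rewrite (smooth_part t (leqW k2) pits s4) => h.
have c1 : 32^-1 ^+ j <= 1 :> R.
  by rewrite exprn_ile1 ?invr_ge0 ?invf_le1 //; lra.
have c0 : 0 <= 32^-1 ^+ j :> R by rewrite exprn_ge0 // invr_ge0.
(* At most four coefficients are units, so one halving multiplies the bound by at least 2/16, which
   exceeds 1/32. *)
have u0 : 2^-1 ^+ 4 <= 2^-1 ^+ (count (pred1 0%N) (exps its)) :> R.
  by apply: ler_wiXn2l => //; lra.
have D0 z : 0 <= dens [seq next_item it | it <- its] (delta k) z.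
  by apply: dens_ge0 => ?; apply: delta_ge0.
rewrite exprS; case/orP: h => [lt|/andP[]].
  have {}lt :
      (nth 0%N (table_dens true 8 (exps its) (coefs its)) (mod8 t))%:R + 1
      <= (nth 0%N (table_dens false 8 (exps its) (coefs its)) (mod8 t))%:R :> R.
    by rewrite natr1 ler_nat.
  case: ifP => t2; last by lra.
  have := D0 (t %/ 2)%Z; move: (dens _ _ _) => D D0'.
  have : 0 <= 2 * 2^-1 ^+ count (pred1 0%N) (exps its) * D.
    by rewrite !mulr_ge0 // exprn_ge0 // invr_ge0.
  by lra.
rewrite negbK => t2; rewrite t2 (odd_mod8_half t2) => good'.
move: ew; rewrite -(ler_nat R).
have := IH k [seq next_item it | it <- its] (t %/ 2)%Z.
rewrite nexts => /(_ jk (proper_nexts pits) pat' good') h ew.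
have {}h :
    32^-1 ^+ j <= dens [seq next_item it | it <- its] (delta k) (t %/ 2)%Z.
  apply: h; apply: contra tj => /dvdzP[q hq].
  by rewrite -(divzK t2) hq -mulrA -exprSr; exact/dvdz_mull/dvdzz.
by move: h u0 c0; move: (dens _ _ _) (2^-1 ^+ count _ _) => D u; nra.
Qed.

(** The multiples of 2^J have frequency 2^-J among the x; the odd half split off at each stage
    contributes a nonnegative amount. *)
Lemma avg_squares_ge d m J g t (c : R) : (J <= m)%N -> (forall t, 0 <= g t) ->
  (forall x : nat, (2 ^ J %| x)%N -> c <= g (t - d * x%:Z ^+ 2)) ->
  2^-1 ^+ J * c <= avg (squares d m) g t.
Proof.
move=> + g0; elim: J d m => [|J IH] d m Jm gc.
  rewrite mul1r avg_squaresE -ler_pdivrMl ?invr_gt0 ?ltr0n ?expn_gt0 // invrK.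
  rewrite mulr_natl -[X in _ *+ X]subn0 -sumr_const_nat ler_sum // => x _.
  exact/gc/dvd1n.
case: m Jm => // m Jm; rewrite avg_squares_split exprS -mulrA.
have o0 : 0 <= avg (odd_squares d m) g t by exact: avg_ge0.
suff : 2^-1 ^+ J * c <= avg (squares (4 * d) m) g t by lra.
apply: IH => // x Jx; have := gc x.*2.
rewrite -muln2 expnSr dvdn_pmul2r // => /(_ Jx).
by congr (_ <= g _); rewrite PoszM; ring.
Qed.

Lemma avg_odd_ge d m g t (c : R) : (0 < m)%N -> (forall t, 0 <= g t) ->
  (forall x : nat, odd x -> c <= g (t - d * x%:Z ^+ 2)) ->
  2^-1 * c <= avg (squares d m) g t.
Proof.
case: m => // m _ g0 gc; rewrite avg_squares_split.
have e0 : 0 <= avg (squares (4 * d) m) g t by exact: avg_ge0.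
suff : c <= avg (odd_squares d m) g t by lra.
rewrite avg_odd_squaresE.
rewrite -ler_pdivrMl ?invr_gt0 ?ltr0n ?expn_gt0 // invrK.
rewrite mulr_natl -[X in _ *+ X]subn0 -sumr_const_nat ler_sum // => x _.
by apply: gc; rewrite /= odd_double.
Qed.

(** Every variable is restricted to multiples of 2^J, so subtracting its term cannot make the
    argument divisible by 2^J; each restriction costs a factor 2^-J. *)
Lemma dens_ge its J g (c : R) : all (fun it : item => J <= it.2)%N its ->
  (forall t, 0 <= g t) -> (forall t, ~~ (2 ^+ J %| t)%Z -> c <= g t) ->
  forall t, ~~ (2 ^+ J %| t)%Z -> (2^-1 ^+ J) ^+ size its * c <= dens its g t.
Proof.
move=> + g0 gc; elim: its => [_|it its IH /= /andP[Jm Jits]] t tJ.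
  by rewrite mul1r gc.
rewrite exprS -mulrA; apply: avg_squares_ge => // [z|x Jx].
  exact: dens_ge0.
apply: IH => //; rewrite rpredBr // dvdz_mull // expr2 dvdz_mulr //.
by rewrite dvdzE abszX.
Qed.

(* Averaging over one more variable moves the argument away from 0, where the
   quaternary bound degenerates. *)
Lemma dens_bounds its it its' k t (J := it.1.2.+1) :
  all (proper_item k) (its ++ it :: its') -> exps its \in patterns ->
  ~~ nonprimitive (exps its) -> (J.+2 <= k)%N ->
  (2^-1 ^+ J) ^+ (size its').+1 * 32^-1 ^+ J
    <= dens (its ++ it :: its') (delta k) t <= 2.
Proof.
rewrite all_cat /= => /and3P[pits pit pits'] pat prim Jk.
have k2 : (2 <= k)%N by apply: leq_trans Jk.
(* With the quaternary average innermost, the other variables only average values already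
   bounded. *)
rewrite dens_cat densC; apply/andP; split; last first.
  apply: dens_le_cst => z; have := dens_upper z k2 pits pat.
  by rewrite /upper_bound (negPf prim).
have g0 z : 0 <= dens its (delta k) z.
  by apply: dens_ge0 => ?; apply: delta_ge0.
have gc z : ~~ (2 ^+ J %| z)%Z -> 32^-1 ^+ J <= dens its (delta k) z.
  by apply: dens_lower => //; rewrite (negPf prim).
have Jm : all (fun it : item => J <= it.2)%N its'.
  by apply: sub_all pits' => i /andP[_]; apply: leq_trans; lia.
have gJ := dens_ge Jm g0 gc.
have dg0 z : 0 <= dens its' (dens its (delta k)) z by exact: dens_ge0.
case/andP: pit => b2 km.
rewrite /= exprS -mulrA; case: (boolP (2 ^+ J %| t)%Z) => tJ; last first.
  apply: avg_squares_ge => // [|x Jx]; first by lia.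
  apply: gJ; rewrite rpredBr // dvdz_mull // expr2 dvdz_mulr //.
  by rewrite dvdzE abszX.
(* If 2^J divides [t], the fifth variable is taken odd: its term has valuation exactly J - 1, so the
   difference is not divisible by 2^J. *)
apply: (@le_trans _ _ (2^-1 * ((2^-1 ^+ J) ^+ size its' * 32^-1 ^+ J))).
  rewrite ler_wpM2r ?mulr_ge0 ?exprn_ge0 ?invr_ge0 //.
  by rewrite /J exprS ler_piMr ?exprn_ile1 //; lra.
apply: avg_odd_ge => // [|x ox]; first by lia.
apply: gJ; rewrite rpredBl // /coef.
have -> : it.1.1 * 2 ^+ it.1.2 * x%:Z ^+ 2
        = 2 ^+ it.1.2 * (it.1.1 * x%:Z ^+ 2) by ring.
have -> : 2 ^+ J = 2 ^+ it.1.2 * 2 :> int by rewrite exprSr.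
rewrite dvdz_mul2l ?expf_neq0 //; move: b2 ox; move: it.1.1 => b b2 ox.
have -> : b * x%:Z ^+ 2 = b * x%:Z * x%:Z by ring.
by lia.
Qed.

End Bounds.

(** * Gauss sums *)

(** On the counted [u], the quotient N u / M is exact, hence injective in [u], and it is less than
    [N]. *)
Lemma count_dvd_mul (M N : nat) : (0 < M)%N -> (0 < N)%N ->
  (count (fun u => M %| N * u) (iota 0 M) <= N)%N.
Proof.
move=> M0 N0; rewrite -size_filter -[leqRHS](size_iota 0).
rewrite -(size_map (fun u => N * u %/ M)%N); apply: uniq_leq_size => [|z].
  rewrite map_inj_in_uniq ?filter_uniq ?iota_uniq // => u v.
  rewrite !mem_filter => /andP[Mu _] /andP[Mv _] e.
  by apply/eqP; rewrite -(eqn_pmul2l N0) -(divnK Mu) e divnK.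
move=> /mapP[u]; rewrite mem_filter !mem_iota !add0n /= => /andP[_ uM] ->.
by rewrite ltn_divLR // ltn_pmul2l.
Qed.

(** * Characters of Z with kernel exactly 2^k Z *)

Section Characters.
Variables (C : numClosedFieldType) (chi : int -> C) (k : nat).
Hypothesis chiD : forall x y, chi (x + y) = chi x * chi y.
Hypothesis chiN : forall x, (chi x)^* = chi (- x).
Hypothesis chi1 : forall x, (chi x == 1) = (2 ^+ k %| x)%Z.

Lemma char0 : chi 0 = 1. Proof. by apply/eqP; rewrite chi1 dvdz0. Qed.

Lemma char_norm x : `|chi x| = 1.
Proof.
apply/eqP; rewrite -(@eqrXn2 _ 2) // expr1n normCK chiN -chiD subrr.
by rewrite char0.
Qed.

Lemma char_dvd x z : (2 ^+ k %| z)%Z -> chi (x + z) = chi x.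
Proof. by rewrite chiD -chi1 => /eqP ->; rewrite mulr1. Qed.

(** For a nontrivial value, multiplying the sum by [chi c - 1] makes it telescope to 0. *)
Lemma char_sum c : \sum_(0 <= y < 2 ^ k) chi (c * y%:Z)
  = if (2 ^+ k %| c)%Z then 2 ^+ k else 0.
Proof.
case: ifP => kc.
  rewrite (eq_bigr (fun=> 1)) => [|y _]; last first.
    by apply/eqP; rewrite chi1 dvdz_mulr.
  by rewrite sumr_const_nat subn0 natrX.
have c1 : chi c - 1 != 0 by rewrite subr_eq0 chi1 kc.
apply: (mulfI c1); rewrite mulr0 mulr_sumr.
under eq_bigr => y _.
  rewrite mulrBl mul1r -chiD (_ : c + _ = c * y.+1%:Z); last first.
    by rewrite intS; ring.
  over.
rewrite (telescope_sumr (fun y : nat => chi (c * y%:Z))) // mulr0 char0.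
apply/eqP; rewrite subr_eq0 chi1 -natz natrX; exact/dvdz_mull/dvdzz.
Qed.

(** Weyl differencing: in the double sum for |S|^2 put x = y + u. The sum over y is then a linear
    character sum, which vanishes unless 2^k divides 2^(r+1) u, and at most 2^(r+1) values of u
    remain. *)
Lemma gauss_sum_bound b r : ~~ (2 %| b)%Z ->
  `|avg (squares (b * 2 ^+ r) k) chi 0| ^+ 2 <= 2 ^+ r.+1 / 2 ^+ k.
Proof.
move=> b2; set d := b * _; rewrite avg_squaresE.
set S := \sum_(0 <= x < _) _.
have M0 : (0 : C) < 2 ^+ k by rewrite exprn_gt0.
suff SS : `|S| ^+ 2 <= 2 ^+ r.+1 * 2 ^+ k.
  rewrite normrM exprMn natrX normfV (ger0_norm (ltW M0)).
  rewrite exprVn -ler_pdivlMl ?invr_gt0 ?exprn_gt0 // invrK.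
  rewrite (le_trans SS) //; move: (2 ^+ k) (2 ^+ r.+1) M0 => M N M0.
  by have -> : M ^+ 2 * (N / M) = N * M by field; rewrite lt0r_neq0.
have S2 : `|S| ^+ 2
    = \sum_(0 <= u < 2 ^ k) chi (- (d * u%:Z ^+ 2))
        * \sum_(0 <= y < 2 ^ k) chi (- (2 * d * u%:Z) * y%:Z).
  rewrite normCK /S rmorph_sum /= mulr_sumr.
  transitivity (\sum_(0 <= y < 2 ^ k) \sum_(0 <= u < 2 ^ k)
      chi (d * y%:Z ^+ 2 - d * (u + y)%:Z ^+ 2)).
    apply: eq_bigr => y _; rewrite mulr_suml.
    rewrite (@sum_shift _ (fun x => chi (d * y%:Z ^+ 2 - d * x%:Z ^+ 2)) _ y).
      by apply: eq_bigr => x _; rewrite chiN -chiD; congr chi; ring.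
    move=> x; rewrite -[RHS](char_dvd _
      (z := - (2 ^+ k * (d * (2 * x%:Z + 2 ^+ k))))).
      by congr chi; rewrite PoszD -[(2 ^ k)%:Z]natz natrX; ring.
    by rewrite rpredN; exact/dvdz_mulr/dvdzz.
  rewrite exchange_big /=; apply: eq_bigr => u _; rewrite mulr_sumr.
  by apply: eq_bigr => y _; rewrite -chiD; congr chi; rewrite PoszD; ring.
have h u : (2 ^+ k %| - (2 * d * u%:Z))%Z = (2 ^ k %| 2 ^ r.+1 * u)%N.
  rewrite rpredN (_ : 2 * d * u%:Z = b * (2 ^ r.+1 * u)%:Z); last first.
    by rewrite /d PoszM -[(2 ^ r.+1)%:Z]natz natrX exprS; ring.
  rewrite dvdzE abszX abszM /= Gauss_dvdr //.
  by rewrite coprimeXl // coprime2n; lia.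
rewrite -(ger0_norm (exprn_ge0 2 (normr_ge0 S))) S2.
apply: le_trans (ler_norm_sum _ _ _) _.
under eq_bigr do rewrite normrM char_norm mul1r char_sum h.
apply: (@le_trans _ _
    (\sum_(0 <= u < 2 ^ k) (2 ^ k %| 2 ^ r.+1 * u)%:R * 2 ^+ k)).
  apply: ler_sum => u _; case: (_ %| _)%N; rewrite ?mul1r ?mul0r ?normr0 //.
  by rewrite ger0_norm // ltW.
rewrite -mulr_suml ler_wpM2r ?(ltW M0) // -natr_sum -natrX ler_nat.
rewrite /index_iota subn0.
apply: leq_trans (@count_dvd_mul (2 ^ k) (2 ^ r.+1) _ _).
- by rewrite -sum1_count [leqRHS]big_mkcond /= leq_sum // => u _; case: ifP.
- by rewrite expn_gt0.
- by rewrite expn_gt0.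
Qed.

(** Characters are eigenvectors of convolution, so the average over several variables factors into
    one-variable sums. *)
Lemma avg_char s t : avg s chi t = chi t * avg s chi 0.
Proof.
rewrite /avg mulrCA; congr (_ * _); rewrite mulr_sumr.
by apply: eq_bigr => z _; rewrite -chiD sub0r.
Qed.

Lemma dens_char its t :
  dens its chi t = chi t * \prod_(it <- its) avg (squares (coef it) it.2) chi 0.
Proof.
elim: its t => [|it its IH] t; first by rewrite big_nil mulr1.
rewrite big_cons /= mulrA -avg_char.
rewrite (_ : dens its chi = fun t =>
  (\prod_(it <- its) avg (squares (coef it) it.2) chi 0) * chi t).
  by rewrite avgZ mulrC.
by apply: funext => z; rewrite IH mulrC.
Qed.

Lemma dens_char_bound its t :
  all (fun it => ~~ (2 %| it.1.1)%Z && (it.2 == k)) its ->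
  `|dens its chi t| ^+ 2 <= \prod_(it <- its) (2 ^+ it.1.2.+1 / 2 ^+ k).
Proof.
move=> aits; rewrite dens_char normrM char_norm mul1r.
rewrite normr_prod -prodrXl big_seq [leRHS]big_seq.
apply: ler_prod => it /(allP aits)/andP[b2 /eqP mk].
by rewrite exprn_ge0 //= mk gauss_sum_bound.
Qed.

End Characters.

(** * 2-adic numbers *)

Lemma Z2_addE (x y : Z2) k : (x + y) k = ((x k + y k) %% 2 ^ k)%N.
Proof. by []. Qed.

Lemma Z2_mulE (x y : Z2) k : (x * y) k = ((x k * y k) %% 2 ^ k)%N.
Proof. by []. Qed.

Lemma Z2_natE n k : (n%:R : Z2) k = (n %% 2 ^ k)%N.
Proof.
elim: n => [|n IH]; first by rewrite mod0n.
by rewrite mulrS Z2_addE IH modnDm.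
Qed.

Lemma Z2_pow2_res k (s : Z2) : (2 ^+ k * s) k = 0%N.
Proof. by rewrite Z2_mulE -natrX Z2_natE modnn mul0n mod0n. Qed.

(** Dropping the lowest [k] binary digits of every residue leaves a coherent sequence, which is the
    quotient. *)
Lemma Z2_decomp (t : Z2) k : exists s, t = (t k)%:R + 2 ^+ k * s.
Proof.
have coh j : (t (k + j) %/ 2 ^ k = (t (k + j.+1) %/ 2 ^ k) %% 2 ^ j)%N.
  by rewrite modn_divl -expnD addnC -(res_leq t (leq_add (leqnSn j) (leqnn k)))
    [(j.+1 + k)%N]addnC.
exists (MkZ2 coh); apply: Z2_ext => j.
rewrite Z2_addE Z2_mulE -natrX !Z2_natE /= modnMml modnDm.
by rewrite -(res_leq t (leq_addr j k)) addnC mulnC -divn_eq res_leq // leq_addl.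
Qed.

Lemma Z2_int_dvd (z : int) k (s : Z2) : z%:~R = 2 ^+ k * s -> (2 ^+ k %| z)%Z.
Proof.
case: z => n; last rewrite NegzE mulrNz => /eqP; rewrite ?eqr_oppLR.
  move=> /(congr1 (fun x : Z2 => x k)); rewrite Z2_pow2_res Z2_natE => h.
  by rewrite dvdzE abszX; apply/eqP.
rewrite -mulrN => /eqP/(congr1 (fun x : Z2 => x k)).
by rewrite Z2_pow2_res Z2_natE => h; rewrite rpredN dvdzE abszX; apply/eqP.
Qed.

Lemma Z2_nat_neq0 n : (0 < n)%N -> (n%:R : Z2) != 0.
Proof.
move=> n0; apply/eqP => /(congr1 (fun x : Z2 => x n)); rewrite Z2_natE.
rewrite modn_small; last exact: ltn_expl.
rewrite [RHS](_ : _ = 0%N); last by [].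
by move=> e; rewrite e in n0.
Qed.

(* The inverse of [1 - 2 w] is the geometric series of [2 w]. *)
Lemma Z2_odd_unit (t : Z2) : odd (t 1%N) -> exists y : Z2, y * t = 1.
Proof.
move=> t1; have [s ts] := Z2_decomp t 1.
have {}ts : 1 - t = 2 * - s.
  have t1E : t 1%N = 1%N.
    by have := res_mod t 1; move: t1; rewrite modn2; case: (t 1%N) => [|[|]]; lia.
  by rewrite [in LHS]ts t1E expr1; ring.
(* The [k]-th power vanishes modulo 2^k, so the [k]-th partial sum is already exact modulo 2^k and
   the partial sums cohere. *)
have xk k : ((1 - t) ^+ k) k = 0%N by rewrite ts exprMn Z2_pow2_res.
pose S k : Z2 := \sum_(i < k) (1 - t) ^+ i.
have coh k : S k k = (S k.+1 k.+1 %% 2 ^ k)%N.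
  rewrite -res_coh [in RHS]/S big_ord_recr /= -/(S k).
  by rewrite xk addn0 res_mod.
exists (MkZ2 coh); apply: Z2_ext => k.
have : S k * t + (1 - t) ^+ k = 1.
  have := subrX1 (1 - t) k; rewrite -/(S k) => /eqP.
  by rewrite subr_eq => /eqP ->; ring.
move=> /(congr1 (fun x : Z2 => x k)); rewrite Z2_addE xk addn0 res_mod => <-.
by [].
Qed.

Lemma Z2_unit_odd (t : Z2) k : t \is a GRing.unit -> (0 < k)%N -> odd (t k).
Proof.
move=> /mulVr/(congr1 (fun x : Z2 => x 1%N)); rewrite Z2_mulE => h k0.
have : odd (t 1%N) by move: h; rewrite expn1 modn2 oddM; do 2!case: odd.
by rewrite -(res_leq t k0) expn1 modn2 oddb.
Qed.

Lemma Z2_pow2_unit (t : Z2) : t != 0 ->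
  exists k (u y : Z2), t = 2 ^+ k * u /\ y * u = 1.
Proof.
move=> /Z2_neq0[i ti _]; have ex : exists i, t i != 0%N by exists i.
(* The least index with a nonzero residue is one more than the valuation; it is not 0, since
   residues modulo 1 vanish. *)
case: (ex_minnP ex) => -[|k] tk kmin.
  by have := res_mod t 0; rewrite expn0 modn1 => h; rewrite -h in tk.
have t0 : t k = 0%N.
  by apply/eqP; apply: contraTT (ltnSn k) => /kmin; rewrite -leqNgt.
have [u] := Z2_decomp t k; rewrite t0 add0r => tu; exists k, u.
have [|y yu] := @Z2_odd_unit u; last by exists y.
apply: contraNT tk => u1; have [v uv] := Z2_decomp u 1.
have u0 : u 1%N = 0%N.
  by have := res_mod u 1; move: u1; rewrite modn2; case: (u 1%N) => [|[|]]; lia.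
by rewrite tu uv u0 add0r expr1 mulrA -exprSr Z2_pow2_res.
Qed.

HB.instance Definition _ := GRing.RMorphism.copy toQ2 (@FracField.tofrac Z2).

Lemma toQ2_inj : injective toQ2.
Proof. by move=> x y /eqP; rewrite tofrac_eq => /eqP. Qed.

Lemma Q2_nat_neq0 n : (0 < n)%N -> (n%:R : Q2) != 0.
Proof. by move=> n0; rewrite -(rmorph_nat toQ2) tofrac_eq0 Z2_nat_neq0. Qed.

Lemma Q2_2_neq0 k : (2 ^+ k : Q2) != 0.
Proof. by rewrite expf_neq0 // Q2_nat_neq0. Qed.

Lemma fractionE (D : idomainType) (x : {fraction D}) :
  exists n d : D, d != 0 /\ x = FracField.tofrac n / FracField.tofrac d.
Proof.
elim/quotW: x => r; exists (frac r).1, (frac r).2.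
have d0 : (frac r).2 != 0 by exact: denom_ratioP.
split=> //; apply: (canRL (mulfK _)); first by rewrite tofrac_eq0.
unlock FracField.tofrac; rewrite -[LHS]FracField.pi_mul; apply/eqmodP/eqP.
by rewrite /= !numden_Ratio ?mulf_neq0 ?oner_neq0 ?mulr1 // mulrC.
Qed.

Lemma Q2_denom (x : Q2) : exists (k : nat) (u : Z2), x = toQ2 u / 2 ^+ k.
Proof.
have [n [d [d0 ->]]] := fractionE x.
have [k [u [y [-> yu]]]] := Z2_pow2_unit d0; exists k, (n * y).
have u0 : toQ2 u != 0.
  rewrite tofrac_eq0; apply: contra_eq_neq yu => ->.
  by rewrite mulr0 eq_sym oner_neq0.
have uy : (toQ2 u)^-1 = toQ2 y.
  by apply: (mulIf u0); rewrite mulVf // -rmorphM yu rmorph1.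
rewrite -!/(toQ2 _) !rmorphM rmorphXn rmorph_nat invfM uy -mulrA.
by rewrite [toQ2 y / _]mulrC.
Qed.

(** [ratr] uses the fraction in lowest terms, so the two fractions are compared by cross
    multiplication. Characteristic 0 suffices, which covers both the reals and Q_2. *)
Lemma ratr_frac (F : fieldType) (p : int) (q : nat) :
  (forall n, (0 < n)%N -> (n%:R : F) != 0) -> (0 < q)%N ->
  ratr (p%:~R / q%:R) = p%:~R / q%:R :> F.
Proof.
move=> F0 q0; set x := _ / _ : rat; rewrite /ratr.
have dF : ((denq x)%:~R : F) != 0.
  have [d hd] : exists d : nat, denq x = d%:Z /\ (0 < d)%N.
    by exists `|denq x|%N; have := denq_gt0 x; lia.
  by rewrite hd.1 F0 // hd.2.
apply/eqP; rewrite eqr_div ?F0 //; apply/eqP.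
rewrite -[q%:R]/(q%:Z%:~R) -!intrM; congr (_%:~R).
apply: (@intr_inj rat); rewrite !intrM numqE /x mulrAC.
by rewrite divfK ?mulr1 // pnatr_eq0 -lt0n.
Qed.

Lemma ratr_odd_denom (x : rat) (p : int) (N : nat) : odd N ->
  x * N%:R = p%:~R -> exists t : Z2, ratr x = toQ2 t.
Proof.
move=> oN xN; have N0 : (0 < N)%N by case: N oN {xN}.
have -> : x = p%:~R / N%:R by rewrite -xN mulfK // pnatr_eq0 -lt0n.
rewrite ratr_frac //; last exact: Q2_nat_neq0.
have [|y yN] := @Z2_odd_unit N%:R; first by rewrite Z2_natE expn1 modn2 oddb.
exists (p%:~R * y); rewrite rmorphM rmorph_int; congr (_ * _).
apply: (mulIf (Q2_nat_neq0 N0)); rewrite mulVf ?Q2_nat_neq0 //.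
by rewrite -[N%:R in RHS](rmorph_nat toQ2) -rmorphM yN rmorph1.
Qed.

(** Clears denominators when two dyadic approximations of one 2-adic number are compared in
    [e2E]. *)
Lemma dyadic_diff (F : fieldType) (z s s' m J K : F) : J != 0 -> K != 0 ->
  (z + K * s) / K - m / J = s' -> z * J - m * K = K * J * (s' - s).
Proof. by move=> J0 K0 <-; field; rewrite J0. Qed.

(** * The additive character of Q_2 on dyadic fractions *)

Section Exponential.
Variable R : realType.

Definition pow2_char (k : nat) (z : int) : R[i] :=
  expi (2 * pi * (z%:~R / 2 ^+ k)).

Lemma expiD (x y : R) : expi (x + y) = expi x * expi y.
Proof.
by rewrite /expi cosD sinD; apply/eqP; rewrite eq_complex /=; apply/andP; split;
  apply/eqP; ring.
Qed.

Lemma expi_int (x : R) (m : int) : expi (x + 2 * pi * m%:~R) = expi x.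
Proof.
have h (n : nat) y : expi (y + 2 * pi * n%:R) = expi y :> R[i].
  rewrite (_ : 2 * pi * n%:R = pi *+ 2 *+ n :> R).
    by rewrite /expi (periodicn (@cosD2pi R)) (periodicn (@sinD2pi R)).
  by rewrite mulr_natr mulr_natl.
case: m => n; first exact: h.
rewrite NegzE mulrNz mulrN; set a := x - _.
by rewrite -(h n.+1 a) /a subrK.
Qed.

Lemma pow2_charD k x y : pow2_char k (x + y) = pow2_char k x * pow2_char k y.
Proof. by rewrite /pow2_char -expiD; congr expi; rewrite intrD; ring. Qed.

Lemma pow2_charN k x : (pow2_char k x)^* = pow2_char k (- x).
Proof.
rewrite /pow2_char mulrNz mulNr mulrN /expi cosN sinN.
by [].
Qed.

Lemma pow2_char_dvd k z : (2 ^+ k %| z)%Z -> pow2_char k z = 1.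
Proof.
move=> /dvdzP[q ->]; rewrite /pow2_char intrM rmorphXn /= mulfK.
  by rewrite -[X in expi X]add0r expi_int /expi cos0 sin0.
by rewrite expf_neq0 // pnatr_eq0.
Qed.

(** After reduction to 0 < y < 1, cos(2 pi y) = 1 - 2 sin(pi y)^2 is less than 1. *)
Lemma pow2_char1 k z : (pow2_char k z == 1) = (2 ^+ k %| z)%Z.
Proof.
apply/idP/idP => [|/pow2_char_dvd->//]; apply: contraLR => kz.
have M0 : (0 : int) < 2 ^+ k by rewrite exprn_gt0.
rewrite (divz_eq z (2 ^+ k)) pow2_charD pow2_char_dvd ?mul1r; last first.
  exact/dvdz_mull/dvdzz.
set r := (z %% _)%Z; have r0 : 0 < r < 2 ^+ k.
  rewrite ltz_pmod // andbT lt_neqAle modz_ge0 ?lt0r_neq0 // andbT eq_sym.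
  by apply: contra kz => /eqP r0; apply/dvdz_mod0P.
rewrite /pow2_char; set y := _ / _ : R.
have y01 : 0 < y < 1.
  have M0' : (0 : R) < 2 ^+ k by rewrite exprn_gt0.
  rewrite divr_gt0 ?ltr0z ?(andP r0).1 //= ltr_pdivrMr // mul1r.
  have -> : (2 ^+ k : R) = (2 ^+ k)%:~R by rewrite rmorphXn.
  by rewrite ltr_int (andP r0).2.
have s0 : 0 < sin (pi * y).
  have p0 := pi_gt0 R; apply: sin_gt0_pi.
  by case/andP: y01 => y0 y1; rewrite mulr_gt0 //= gtr_pMr.
have -> : 2 * pi * y = (pi * y) *+ 2 by ring.
rewrite eq_complex /= cos_mulr2n cos2sin2; apply/negP => /andP[/eqP c1 _].
by have := exprn_gt0 2 s0; lra.
Qed.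

(** The fraction chosen by [e2] and z / 2^k differ by a dyadic rational lying in Z_2, hence by an
    integer, which the exponential ignores. The sign comes from the definition of [e2]. *)
Lemma e2E (t s : Z2) (z : int) k : t = z%:~R + 2 ^+ k * s ->
  e2 R (toQ2 t / 2 ^+ k) = pow2_char k (- z).
Proof.
move=> ts; have P2 j : (2 ^+ j : rat) != 0 by rewrite expf_neq0.
have dy (m : int) j : ratr (m%:~R / 2 ^+ j) = m%:~R / 2 ^+ j :> Q2.
  rewrite -natrX ratr_frac ?natrX ?expn_gt0 // => n; exact: Q2_nat_neq0.
have ex : is_dyadic (z%:~R / 2 ^+ k) /\
    Z2_in_Q2 (toQ2 t / 2 ^+ k - ratr (z%:~R / 2 ^+ k)).
  split; first by exists z, k.
  exists s => //; rewrite dy -mulrBl ts rmorphD rmorph_int addrC addKr.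
  by rewrite rmorphM rmorphXn rmorph_nat mulrC mulKf // Q2_2_neq0.
rewrite /e2; set y := get _.
have [[m [j yj]] [s' _ hs']] :
    is_dyadic y /\ Z2_in_Q2 (toQ2 t / 2 ^+ k - ratr y).
  apply: (@getPex _ [set y : rat | is_dyadic y /\
    Z2_in_Q2 (toQ2 t / 2 ^+ k - ratr y)]).
  by exists (z%:~R / 2 ^+ k).
have /dvdzP[q hq] : (2 ^+ (k + j) %| z * 2 ^+ j - m * 2 ^+ k)%Z.
  apply: (@Z2_int_dvd _ _ (s' - s)); apply: toQ2_inj.
  rewrite yj dy ts rmorphD rmorphM rmorphXn rmorph_nat rmorph_int in hs'.
  have := dyadic_diff (Q2_2_neq0 j) (Q2_2_neq0 k) (esym hs').
  rewrite rmorph_int intrB !intrM !rmorphXn /= => ->.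
  by rewrite rmorphM rmorphXn rmorphB rmorph_nat exprD.
rewrite yj /pow2_char; have -> : (ratr (m%:~R / 2 ^+ j) : R) = m%:~R / 2 ^+ j.
  by rewrite -natrX ratr_frac ?natrX ?expn_gt0 // => n; rewrite pnatr_eq0 -lt0n.
rewrite -(expi_int _ (- q)); congr expi; rewrite !mulrNz.
have {hq} : z%:~R * 2 ^+ j - m%:~R * 2 ^+ k = q%:~R * (2 ^+ k * 2 ^+ j) :> R.
  have := congr1 (fun x : int => x%:~R : R) hq.
  by rewrite !(intrB, intrM, rmorphXn) /= exprD.
have : (2 ^+ j : R) != 0 by rewrite expf_neq0 // pnatr_eq0.
have : (2 ^+ k : R) != 0 by rewrite expf_neq0 // pnatr_eq0.
move: (2 ^+ j) (2 ^+ k) => J K K0 J0 e.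
have -> : q%:~R = z%:~R / K - m%:~R / J.
  by apply: (mulIf (mulf_neq0 K0 J0)); rewrite -e; field; rewrite K0 J0.
by ring.
Qed.

End Exponential.

(** * Integrals of locally constant functions *)

Section Partitions.
Context d (T : measurableType d) (R : realType).
Variable mu : {measure set T -> \bar R}.

Lemma integral_partition (I : finType) (A : I -> set T) (p : R) (c : I -> R)
    (f : T -> R) :
  (forall i, measurable (A i)) -> (forall i, mu (A i) = p%:E) ->
  (forall i j x, A i x -> A j x -> i = j) ->
  (forall i x, A i x -> f x = c i) ->
  (forall x, (forall i, ~ A i x) -> f x = 0) ->
  (\int[mu]_x (f x)%:E = (\sum_i c i * p)%:E)%E.
Proof.
move=> mA muA triv fc f0.
have int1 i : mu.-integrable setT (fun x => (\1_(A i) x)%:E).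
  apply/integrableP; split; first exact/measurable_EFinP/measurable_indic.
  under eq_integral do rewrite gee0_abs ?lee_fin //.
  by rewrite integral_indic // setIT muA ltry.
transitivity (\int[mu]_x (\sum_i (c i)%:E * (\1_(A i) x)%:E))%E.
  apply: eq_integral => x _; case: (pselect (exists i, A i x)) => [[i Ai]|nA].
    rewrite (fc i x Ai) (bigD1 i) //= indicE mem_set // mule1 big1 ?adde0 //.
    move=> j ji; rewrite indicE memNset ?mule0 // => Aj.
    by rewrite (triv _ _ _ Aj Ai) eqxx in ji.
  rewrite f0 => [|i Ai]; last by apply: nA; exists i.
  rewrite big1 // => i _; rewrite indicE memNset ?mule0 // => Ai.
  by apply: nA; exists i.
rewrite integral_sum //; last by move=> i; exact: integrableZl.
rewrite -sumEFin; apply: eq_bigr => i _; rewrite integralZl // integral_indic //.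
by rewrite setIT muA.
Qed.

Lemma cintegral_partition (I : finType) (A : I -> set T) (p : R) (c : I -> R[i])
    (f : T -> R[i]) :
  (forall i, measurable (A i)) -> (forall i, mu (A i) = p%:E) ->
  (forall i j x, A i x -> A j x -> i = j) ->
  (forall i x, A i x -> f x = c i) ->
  (forall x, (forall i, ~ A i x) -> f x = 0) ->
  cintegral mu f = (\sum_i c i) * real_complex R p.
Proof.
move=> mA muA triv fc f0; rewrite /cintegral /Rintegral.
rewrite (@integral_partition I A p (fun i => complex.Re (c i))) //; first last.
- by move=> x /f0 ->.
- by move=> i x /fc ->.
rewrite (@integral_partition I A p (fun i => complex.Im (c i))) //; first last.
- by move=> x /f0 ->.
- by move=> i x /fc ->.
rewrite mulr_suml (eq_bigr (fun i =>
  Complex (complex.Re (c i) * p) (complex.Im (c i) * p))) => [|i _].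
  by elim/big_ind3 : _ => // a b _ a' b' _ <- <- .
by case: (c i) => a b; apply/eqP; rewrite eq_complex /= !mulr0 subr0 add0r !eqxx.
Qed.

End Partitions.

Lemma borel_open (T : ptopologicalType) (A : set T) :
  open A -> measurable (A : set (borel T)).
Proof. exact: sub_sigma_algebra. Qed.

Lemma measurable_open_preimages (T : ptopologicalType) (R : realType)
    (f : T -> R) : (forall B, open (f @^-1` B)) ->
  measurable_fun setT (f : borel T -> R).
Proof. move=> opre _ B _; rewrite setTI; apply: borel_open; exact: opre. Qed.

Lemma Q2_translate_open (x : Q2) : open [set x + y | y in Z2_in_Q2].
Proof.
move=> _ [_ [t _ <-] <-]; exists 0%N => _ [t' _ <-].
exists (toQ2 (t + t')); first by exists (t + t').
by rewrite expr0 mul1r rmorphD addrA.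
Qed.

(** * Coordinates on L_2 and the sublattices 2^k L_2 *)

Section Lattice.
Variables (n : nat) (P : 'M[Z2]_n).
Hypothesis uP : P \in unitmx.

(** The point with coordinates [y] in the basis formed by the rows of [P]. *)
Definition lattice_pt (y : 'rV[Z2]_n) : V2 n := map_mx toQ2 (y *m P).

Lemma lattice_ptD y z : lattice_pt (y + z) = lattice_pt y + lattice_pt z.
Proof. by rewrite /lattice_pt mulmxDl map_mxD. Qed.

Lemma lattice_pt_surj (y : 'rV[Z2]_n) :
  map_mx toQ2 y = lattice_pt (y *m invmx P).
Proof. by rewrite /lattice_pt mulmxKV. Qed.

Lemma lattice_pt_inj : injective lattice_pt.
Proof.
move=> y z /matrixP yz; apply: (can_inj (mulmxK uP)).
apply/matrixP => i j; apply: toQ2_inj; have := yz i j.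
by rewrite !mxE.
Qed.

Lemma L2_lattice w : L2 w <-> exists y, w = lattice_pt y.
Proof.
split=> [Lw|[y ->] i]; last by rewrite mxE; exists ((y *m P) 0 i).
have /choice[t ht] : forall i, exists t : Z2, toQ2 t = w 0 i.
  by move=> i; have [t _ ht] := Lw i; exists t.
exists ((\row_i t i) *m invmx P); rewrite -lattice_pt_surj.
by apply/rowP => i; rewrite !mxE ht.
Qed.

Definition sublattice (k : nat) : set (V2 n) :=
  [set lattice_pt (2 ^+ k *: y) | y in setT].

Lemma sublattice_translate_open k w : open [set w + v | v in sublattice k].
Proof.
rewrite openE => _ [_ [y _ <-] <-]; set v := w + _.
(* The matrix topology is entrywise; since [P] is invertible over Z_2, a product of cosets of 2^k
   Z_2 is a coset of 2^k L_2 in the new basis too. *)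
exists (fun i j => Q2_coset (v i j) k) => [i j|v' vv'].
  apply/(@open_nbhs_nbhs Q2); split.
    move=> _ [t _ <-]; exists k => _ [t' _ <-]; exists (t + t') => //.
    by rewrite rmorphD mulrDr addrA.
  by exists 0; rewrite // rmorph0 mulr0 addr0.
have /choice[t ht] : forall j, exists t : Z2, v 0 j + 2 ^+ k * toQ2 t = v' 0 j.
  by move=> j; have [t _ ht] := vv' 0 j; exists t.
exists (lattice_pt (2 ^+ k *: (y + (\row_i t i) *m invmx P))); first by eexists.
rewrite scalerDr lattice_ptD addrA -/v scalemxAl -lattice_pt_surj.
apply/rowP => j; rewrite [LHS]mxE -ht; congr (_ + _).
by rewrite !mxE rmorphM rmorphXn rmorph_nat.
Qed.

End Lattice.

Lemma sum_tuple_dens (C : numFieldType) (g : int -> C) n (f : 'I_n -> item) k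
    t :
  (forall i, (f i).2 = k) ->
  \sum_(x : n.-tuple 'I_(2 ^ k))
     g (t - \sum_i coef (f i) * (tnth x i)%:Z ^+ 2)
  = ((2 ^ k) ^ n)%:R * dens [seq f i | i <- enum 'I_n] g t.
Proof.
elim: n f t => [|n IH] f t fk.
  rewrite (big_pred1 [tuple]) => [|x]; last by rewrite [x]tuple0 /= eqxx.
  by rewrite big_ord0 subr0 enum_ord0 /= mul1r.
rewrite (reindex (fun p : 'I_(2 ^ k) * n.-tuple 'I_(2 ^ k) =>
    [tuple of p.1 :: p.2])) /=; last first.
  exists (fun x => (thead x, [tuple of behead x])) => [[a x]|x] _ /=.
    by congr pair; apply: val_inj.
  by rewrite -tuple_eta.
rewrite -(pair_big xpredT xpredT (fun a (x : n.-tuple 'I_(2 ^ k)) =>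
  g (t - \sum_i coef (f i) * (tnth [tuple of a :: x] i)%:Z ^+ 2))) /=.
under eq_bigr => a _.
  under eq_bigr => x _.
    rewrite big_ord_recl; under eq_bigr do rewrite tnthS.
    rewrite tnth0 opprD addrA; over.
  rewrite (IH (fun i => f (lift ord0 i))); last by move=> i; exact: fk.
  over.
rewrite -mulr_sumr enum_ordSl /= -map_comp avg_squaresE fk big_mkord.
rewrite expnS natrM mulrA; congr (_ * _); by rewrite mulrC mulKf.
Qed.

Definition congz (k : nat) (t : Z2) (z : int) :=
  exists s, t = z%:~R + 2 ^+ k * s.

Lemma congz_res k (t : Z2) : congz k t (t k)%:Z.
Proof. exact: Z2_decomp. Qed.

Lemma congz_pred k t z : congz k.+1 t z -> congz k t z.
Proof. by move=> [s ->]; exists (2 * s); rewrite exprSr mulrA. Qed.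

Lemma congz0 k : congz k 0 0.
Proof. by exists 0; rewrite mulr0 addr0. Qed.

Lemma congzD k t t' z z' : congz k t z -> congz k t' z' ->
  congz k (t + t') (z + z').
Proof. by move=> [s ->] [s' ->]; exists (s + s'); rewrite intrD; ring. Qed.

Lemma congzN k t z : congz k t z -> congz k (- t) (- z).
Proof. by move=> [s ->]; exists (- s); rewrite mulrNz; ring. Qed.

Lemma congzM k t t' z z' : congz k t z -> congz k t' z' ->
  congz k (t * t') (z * z').
Proof.
move=> [s ->] [s' ->].
by exists (z%:~R * s' + s * z'%:~R + 2 ^+ k * (s * s')); rewrite intrM; ring.
Qed.

Lemma congz_sum k (I : finType) (t : I -> Z2) (z : I -> int) :
  (forall i, congz k (t i) (z i)) -> congz k (\sum_i t i) (\sum_i z i).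
Proof.
move=> h; elim/big_ind2 : _ => [|? ? ? ?|//]; first exact: congz0.
exact: congzD.
Qed.

(** * The integral over V_2 as a finite average *)

Section InnerIntegral.
Variables (R : realType) (n : nat) (P : 'M[Z2]_n).
Hypothesis uP : P \in unitmx.
Variable dv : {measure set (borel (V2 n)) -> \bar R}.
Hypothesis haar_dv : normalized_haar <<s @open (V2 n) >> (@L2 n) dv.

Definition coset k (x : n.-tuple 'I_(2 ^ k)) : set (V2 n) :=
  [set lattice_pt P y
     | y in [set y : 'rV[Z2]_n | forall i, (y 0 i : Z2) k = tnth x i]].

Lemma cosetE k (x : n.-tuple 'I_(2 ^ k)) :
  coset x = [set lattice_pt P (\row_i (tnth x i)%:R) + v | v in sublattice P k].
Proof.
apply/seteqP; split=> [_ [y yx <-]|_ [_ [z _ <-] <-]].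
  have /choice[s hs] i := Z2_decomp (y 0 i) k.
  exists (lattice_pt P (2 ^+ k *: \row_i s i)); first by eexists.
  rewrite -lattice_ptD; congr lattice_pt; apply/rowP => i.
  by rewrite !mxE [RHS]hs yx.
exists (\row_i (tnth x i)%:R + 2 ^+ k *: z); last by rewrite lattice_ptD.
move=> i; rewrite !mxE Z2_addE Z2_natE Z2_pow2_res addn0 modn_mod.
by rewrite modn_small.
Qed.

Lemma sublattice_open k : open (sublattice P k).
Proof.
have := @sublattice_translate_open n P uP k 0; congr open.
apply/seteqP; split=> [_ [v ? <-]|v ?]; first by rewrite add0r.
by exists v; rewrite ?add0r.
Qed.

Lemma measurable_coset k (x : n.-tuple 'I_(2 ^ k)) :
  measurable (coset x : set (borel (V2 n))).
Proof.
by rewrite cosetE; apply: borel_open; apply: sublattice_translate_open.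
Qed.

Lemma coset_disjoint k (x x' : n.-tuple 'I_(2 ^ k)) w :
  coset x w -> coset x' w -> x = x'.
Proof.
move=> [y yx <-] [y' y'x' /(lattice_pt_inj uP) yy']; apply: eq_from_tnth => i.
by apply: val_inj; rewrite /= -yx -y'x' yy'.
Qed.

Lemma coset_cover k (y : 'rV[Z2]_n) : exists x : n.-tuple 'I_(2 ^ k),
  forall i, (y 0 i : Z2) k = tnth x i.
Proof.
have lt i : (res (y 0%R i) k < 2 ^ k)%N by rewrite -res_mod ltn_mod expn_gt0.
by exists [tuple Ordinal (lt i) | i < n] => i; rewrite tnth_mktuple.
Qed.

Lemma coset_L2 k w : L2 w <-> exists x : n.-tuple 'I_(2 ^ k), coset x w.
Proof.
split=> [/(L2_lattice uP)[y ->]|[x [y _ <-]]]; last first.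
  by apply/(L2_lattice uP); exists y.
by have [x yx] := coset_cover k y; exists x, y.
Qed.

(** L_2 has measure 1 and is the disjoint union of 2^(kn) cosets, of equal measure by translation
    invariance. *)
Lemma coset_measure k (x : n.-tuple 'I_(2 ^ k)) :
  dv (coset x) = (((2 ^ k) ^ n)%:R^-1)%:E.
Proof.
have [dvL dvT] := haar_dv.
have mH : measurable (sublattice P k : set (borel (V2 n))).
  by apply: borel_open; exact: sublattice_open.
have dvx (y : n.-tuple 'I_(2 ^ k)) : dv (coset y) = dv (sublattice P k).
  by rewrite cosetE; apply: dvT; exact: mH.
have LE : @L2 n = \bigcup_(x : n.-tuple 'I_(2 ^ k)) coset x.
  by apply/seteqP; split=> [w /(coset_L2 k)[y]|w [y _ yw]];
    [exists y | apply/(coset_L2 k); exists y].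
have mL : measurable (@L2 n : set (borel (V2 n))).
  rewrite LE; apply: fin_bigcup_measurable => // y _.
  exact: measurable_coset.
have H1 : (dv (sublattice P k) <= 1)%E.
  rewrite -dvL le_measure ?inE // => _ [y _ <-].
  by apply/(L2_lattice uP); exists (2 ^+ k *: y).
(* The common measure must be known to be finite before the equation for it is solved in the
   reals. *)
have [p pE] : exists p : R, dv (sublattice P k) = p%:E.
  exists (fine (dv (sublattice P k))); rewrite fineK //.
  by rewrite ge0_fin_numE ?measure_ge0 // (le_lt_trans H1) ?ltry.
rewrite dvx pE; congr _%:E.
have : (\int[dv]_w (\1_(@L2 n) w)%:E
    = (\sum_(y : n.-tuple 'I_(2 ^ k)) 1 * p)%:E)%E.
  apply: (@integral_partition _ _ _ dv _ (@coset k)).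
  - exact: measurable_coset.
  - by move=> y; rewrite dvx.
  - exact: coset_disjoint.
  - by move=> y w yw; rewrite indicE mem_set //; apply/(coset_L2 k); exists y.
  - move=> w nw; rewrite indicE memNset // => /(coset_L2 k)[y].
    exact: nw.
rewrite integral_indic // setIT [LHS]dvL => -[].
rewrite -mulr_suml sumr_const card_tuple card_ord.
have N0 : ((2 ^ k) ^ n)%:R != 0 :> R by rewrite pnatr_eq0 !expn_eq0.
by move=> e; rewrite -[p](mulKf N0) -e mulr1.
Qed.

Lemma cintegral_lattice k (f : V2 n -> R[i]) (c : n.-tuple 'I_(2 ^ k) -> R[i]) :
  (forall (x : n.-tuple 'I_(2 ^ k)) (y : 'rV[Z2]_n),
     (forall i, (y 0 i : Z2) k = tnth x i) ->
     f (lattice_pt P y) = c x) ->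
  (forall w, ~ L2 w -> f w = 0) ->
  cintegral dv (f : borel (V2 n) -> R[i]) = (\sum_x c x) / ((2 ^ k) ^ n)%:R.
Proof.
move=> fc f0; rewrite (@cintegral_partition _ _ _ dv _ (@coset k) _ c _
  (@measurable_coset k) (@coset_measure k) (@coset_disjoint k)).
- by rewrite fmorphV rmorph_nat.
- by move=> x _ [y yx <-]; exact: fc.
- move=> w nw; apply: f0 => /(coset_L2 k)[x]; exact: nw.
Qed.

Variables (beta : 'I_n -> Z2) (r : 'I_n -> nat) (phi : V2 n -> Q2).
Hypothesis phiE : forall y : 'rV[Z2]_n,
  phi (lattice_pt P y) = toQ2 (\sum_i beta i * 2 ^+ r i * y 0 i ^+ 2).

(* Residues at level [k + 1], so that they are odd even when [k = 0]. *)
Definition items k : seq item :=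
  [seq ((beta i k.+1)%:Z, r i, k) | i <- enum 'I_n].

(** For sigma = u / 2^k the integrand is constant on the cosets of 2^k L_2. The minus sign of [e2E]
    turns phi - h into h - phi, the argument of [dens]. *)
Lemma inner_integral (u eta : Z2) k (A H : int) :
  congz k u A -> congz k eta H ->
  cintegral dv (fun w : borel (V2 n) =>
    e2 R (toQ2 u / 2 ^+ k * (phi w - toQ2 eta)) * real_complex R (\1_(@L2 n) w))
  = dens (items k) (fun z => pow2_char R k (A * z)) H.
Proof.
move=> uA eH; pose it i : item := ((beta i k.+1)%:Z, r i, k).
rewrite (@cintegral_lattice k _ (fun x => pow2_char R k
    (A * (H - \sum_i coef (it i) * (tnth x i)%:Z ^+ 2)))); first last.
- by move=> w nw; rewrite indicE memNset // mulr0.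
- move=> x y yx; rewrite indicE mem_set; last first.
    by apply/(L2_lattice uP); exists y.
  rewrite mulr1 phiE -rmorphB mulrAC -rmorphM.
  have [s hs] : congz k (u * (\sum_i beta i * 2 ^+ r i * y 0 i ^+ 2 - eta))
      (A * (\sum_i coef (it i) * (tnth x i)%:Z ^+ 2 - H)).
    apply/congzM/congzD/congzN => //; apply: congz_sum => i.
    rewrite !expr2; apply/congzM; last first.
      by apply: congzM; rewrite -yx; apply: congz_res.
    apply: congzM; first exact/congz_pred/congz_res.
    by exists 0; rewrite mulr0 addr0 rmorphXn.
  by rewrite (e2E _ hs); congr pow2_char; ring.
rewrite (@sum_tuple_dens _ (fun z => pow2_char R k (A * z))) //.
by rewrite mulrC mulKf // pnatr_eq0 !expn_eq0.
Qed.

End InnerIntegral.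

(** * The integral over Q_2 as a limit over 2^-k Z_2 *)

Section OuterIntegral.
Variables (R : realType) (ds : {measure set (borel Q2) -> \bar R}).
Hypothesis haar_ds : normalized_haar <<s @open Q2 >> Z2_in_Q2 ds.

Definition level (k : nat) : set Q2 := [set toQ2 u / 2 ^+ k | u in setT].
Definition level_coset k (a : 'I_(2 ^ k)) : set Q2 :=
  [set toQ2 u / 2 ^+ k | u in [set u : Z2 | u k = a]].

Lemma level_le j k : (j <= k)%N -> level j `<=` level k.
Proof.
move=> /subnKC <- _ [u _ <-]; exists (2 ^+ (k - j) * u) => //.
rewrite rmorphM rmorphXn rmorph_nat exprD [2 ^+ j * _]mulrC -mulf_div.
by rewrite divff ?Q2_2_neq0 // mul1r.
Qed.

Lemma level_coset_translate k (a : 'I_(2 ^ k)) :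
  level_coset a = [set a%:R / 2 ^+ k + y | y in Z2_in_Q2].
Proof.
apply/seteqP; split=> [_ [u ua <-]|_ [_ [t _ <-] <-]].
  have [s us] := Z2_decomp u k; exists (toQ2 s); first by exists s.
  rewrite [in RHS]us ua rmorphD rmorph_nat rmorphM rmorphXn rmorph_nat mulrDl.
  by rewrite [_ * toQ2 s]mulrC mulfK ?Q2_2_neq0.
exists (a%:R + 2 ^+ k * t).
  suff : (a%:R + 2 ^+ k * t : Z2) k = a by [].
  by rewrite Z2_addE Z2_natE Z2_pow2_res addn0 modn_mod modn_small.
rewrite rmorphD rmorph_nat rmorphM rmorphXn rmorph_nat mulrDl.
by rewrite [_ * toQ2 t]mulrC mulfK ?Q2_2_neq0.
Qed.

Lemma measurable_level_coset k (a : 'I_(2 ^ k)) :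
  measurable (level_coset a : set (borel Q2)).
Proof.
by rewrite level_coset_translate; apply: borel_open; exact: Q2_translate_open.
Qed.

Lemma level_coset_measure k (a : 'I_(2 ^ k)) : ds (level_coset a) = 1%:E.
Proof.
have [ds1 dsT] := haar_ds; rewrite level_coset_translate -ds1.
apply: dsT; apply: sub_sigma_algebra.
have := @Q2_translate_open 0; congr open.
apply/seteqP; split=> [_ [v ? <-]|v ?]; first by rewrite add0r.
by exists v; rewrite ?add0r.
Qed.

Lemma level_coset_disjoint k (a b : 'I_(2 ^ k)) s :
  level_coset a s -> level_coset b s -> a = b.
Proof.
move=> [u ua <-] [w wb /(mulIf _)].
rewrite invr_neq0 ?Q2_2_neq0 // => /(_ isT)/toQ2_inj wu.
by apply: val_inj; rewrite /= -ua -wb wu.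
Qed.

Lemma level_cosets k s : level k s <-> exists a : 'I_(2 ^ k), level_coset a s.
Proof.
split=> [[u _ <-]|[a [u _ <-]]]; last by exists u.
have ltu : (u k < 2 ^ k)%N by rewrite -res_mod ltn_mod expn_gt0.
by exists (Ordinal ltu), u.
Qed.

(** A function with all of Z_2 as periods is locally constant, so all its preimages are open. *)
Lemma measurable_periodic (g : Q2 -> R) : (forall s t, g (s + toQ2 t) = g s) ->
  measurable_fun setT (g : borel Q2 -> R).
Proof.
move=> gp; apply: measurable_open_preimages => B.
suff : Q2_open (g @^-1` B) by [].
move=> s Bs; exists 0%N => _ [t _ <-].
by rewrite /preimage /= expr0 mul1r gp.
Qed.

Lemma level_periodic k s t : level k (s + toQ2 t) <-> level k s.
Proof.
have h s' t' : level k s' -> level k (s' + toQ2 t').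
  move=> [u _ <-]; exists (u + 2 ^+ k * t') => //.
  rewrite rmorphD rmorphM rmorphXn rmorph_nat mulrDl.
  by rewrite [_ * toQ2 t']mulrC mulfK ?Q2_2_neq0.
split; last exact: h.
by move=> /(h _ (- t)); rewrite rmorphN addrK.
Qed.

Lemma indic_level_periodic k s t :
  \1_(level k) (s + toQ2 t) = \1_(level k) s :> R.
Proof.
rewrite !indicE; congr (_%:R); congr nat_of_bool.
by apply/idP/idP; rewrite !inE => /level_periodic.
Qed.

Variables (f : Q2 -> R) (Psi : nat -> int -> R) (W : R).
Hypothesis fE : forall u k A, congz k u A -> f (toQ2 u / 2 ^+ k) = Psi k A.
Hypothesis W0 : 0 <= W.
Hypothesis Psi_bound : forall k A, (k == 0)%N || ~~ (2 %| A)%Z ->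
  `|Psi k A| <= W / 8 ^+ k.

Lemma level_function_periodic s t : f (s + toQ2 t) = f s.
Proof.
have [k [u ->]] := Q2_denom s; have [v uv] := congz_res k u.
rewrite (fE (congz_res k u)) -(@fE (u + 2 ^+ k * t) k (u k)%:Z).
  congr f; rewrite rmorphD rmorphM rmorphXn rmorph_nat mulrDl.
  by rewrite [_ * toQ2 t]mulrC mulfK ?Q2_2_neq0.
by exists (v + t); rewrite {1}uv; ring.
Qed.

(** The least level containing [s] is taken: there the numerator is odd or the level is 0, which is
    what [Psi_bound] requires. *)
Lemma level_function_bound s : exists2 k, level k s & `|f s| <= W / 8 ^+ k.
Proof.
have exk : exists k, `[< level k s >].
  by have [k [u ->]] := Q2_denom s; exists k; apply/asboolP; exists u.
case: (ex_minnP exk) => k /asboolP[u _ su] kmin.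
exists k; first by exists u.
rewrite -su (fE (congz_res k u)) Psi_bound //.
case: k u su kmin => // k u su kmin; apply/orP; right; apply/negP => u2.
have [v uv] := Z2_decomp u 1.
have u1 : u 1%N = 0%N.
  by rewrite -(res_leq u (ltn0Sn k)) expn1; move: u2; move: (u k.+1) => x; lia.
have : level k s.
  exists v => //; rewrite -su uv u1 add0r expr1 rmorphM rmorph_nat.
  by rewrite exprS invfM mulrA [2 * _]mulrC mulfK ?(@Q2_nat_neq0 2).
by move/asboolP/kmin; rewrite ltnn.
Qed.

Lemma integral_level k (c : 'I_(2 ^ k) -> R) (g : Q2 -> R) :
  (forall a s, level_coset a s -> g s = c a) ->
  (\int[ds]_(s in [set: borel Q2]) (g s * \1_(level k) s)%:E
   = (\sum_a c a)%:E)%E.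
Proof.
move=> gc.
rewrite (@integral_partition _ _ _ ds _ (@level_coset k) 1 c) //.
- by under eq_bigr do rewrite mulr1.
- exact: measurable_level_coset.
- exact: level_coset_measure.
- exact: level_coset_disjoint.
- move=> a s sa; rewrite (gc _ _ sa) indicE mem_set ?mulr1 //.
  by apply/level_cosets; exists a.
- move=> s na; rewrite indicE memNset ?mulr0 // => /level_cosets[a].
  exact: na.
Qed.

(** Summands of the dominating function. Level [k] consists of 2^k cosets of measure 1, so this one
    has integral W / 4^k and the series converges. *)
Let dom k s : \bar R := (W / 8 ^+ k * \1_(level k) s)%:E.

Lemma dom_ge0 k s : (0 <= dom k s)%E.
Proof. by rewrite lee_fin mulr_ge0 // divr_ge0 // exprn_ge0. Qed.

Lemma measurable_dom k : measurable_fun setT (dom k : borel Q2 -> \bar R).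
Proof.
apply/measurable_EFinP; apply: measurable_periodic => s t.
by rewrite indic_level_periodic.
Qed.

Lemma integrable_dom :
  ds.-integrable setT (fun s : borel Q2 => \sum_(0 <= k <oo) dom k s)%E.
Proof.
apply/integrableP; split.
  apply: (@ge0_emeasurable_sum _ _ _ _ (dom : nat -> borel Q2 -> \bar R) xpredT).
    by move=> k s _ _; exact: dom_ge0.
  by move=> k _; exact: measurable_dom.
under eq_integral => s _.
  rewrite gee0_abs; last by apply: nneseries_ge0 => k _ _; exact: dom_ge0.
  over.
rewrite integral_nneseries //; last first.
- by move=> k s _; exact: dom_ge0.
- by move=> k; exact: measurable_dom.
have intE k :
    (\int[ds]_(s in [set: borel Q2]) dom k s = (geometric W 4^-1 k)%:E)%E.
  rewrite (@integral_level k (fun=> W / 8 ^+ k)) // sumr_const card_ord.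
  congr _%:E; rewrite /= -[LHS]mulr_natr natrX -mulrA exprVn; congr (_ * _).
  have -> : (8 : R) = 4 * 2 by ring.
  by rewrite exprMn invfM mulfVK // expf_neq0 // pnatr_eq0.
rewrite (eq_eseriesr (fun k _ => intE k)).
apply: (@le_lt_trans _ _ (W / (1 - 4^-1))%:E); last exact: ltry.
have g0 k : (0 <= (geometric W 4^-1 k)%:E)%E.
  by rewrite lee_fin /= mulr_ge0 // exprn_ge0 // invr_ge0.
apply: lime_le; first by apply: is_cvg_nneseries => k _ _; exact: g0.
apply: nearW => m; rewrite sumEFin lee_fin; apply: geometric_le_lim => //.
by rewrite ger0_norm ?invr_ge0 // invf_lt1 //; lra.
Qed.

(** Dominated convergence along the levels, which exhaust Q_2; at each point the truncations are
    eventually constant, and a single term [dom k s] bounds them all. *)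
Lemma outer_integral :
  (fun K => \sum_(a < 2 ^ K) Psi K a%:Z : R) @ \oo
    --> (Rintegral ds [set: borel Q2] f : R).
Proof.
have fc K (a : 'I_(2 ^ K)) s : level_coset a s -> f s = Psi K a%:Z.
  by move=> [u ua <-]; apply: fE; rewrite -ua; exact: congz_res.
have [] := @dominated_convergence _ _ _ ds setT measurableT
  (fun K s => (f s * \1_(level K) s)%:E) (fun s => (f s)%:E)
  (fun s => \sum_(0 <= k <oo) dom k s)%E.
- move=> K; apply/measurable_EFinP; apply: measurable_periodic => s t.
  by rewrite level_function_periodic indic_level_periodic.
- by apply/measurable_EFinP; apply: measurable_periodic; exact: level_function_periodic.
- apply: aeW => s _; have [k ks _] := level_function_bound s.
  apply: cvg_near_cst; exists k => // K /= kK.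
  by rewrite indicE mem_set ?mulr1 //; exact: level_le ks.
- exact: integrable_dom.
- apply: aeW => s K _; have [k ks fs] := level_function_bound s.
  apply: (@le_trans _ _ (dom k s)).
    rewrite /dom [in leRHS]indicE mem_set // mulr1 abse_EFin lee_fin normrM.
    apply: le_trans fs; rewrite ler_piMr // indicE.
    by case: (_ \in _); rewrite ?normr1 ?normr0.
  have := @nneseries_lim_ge _ (dom^~ s) xpredT 0 k.+1
    (fun j _ _ => dom_ge0 j s).
  apply: le_trans; rewrite big_nat_recr //=.
  by rewrite leeDr // sume_ge0 // => j _; exact: dom_ge0.
move=> intf _ cv; rewrite /Rintegral.
have fin : (\int[ds]_(s in [set: borel Q2]) (f s)%:E)%E \is a fin_num.
  exact: integrable_fin_num intf.
rewrite -(fineK fin) in cv.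
rewrite (_ : (fun K => _) = fine \o (fun K =>
    \int[ds]_(s in [set: borel Q2]) (f s * \1_(level K) s)%:E)%E).
  exact: fine_cvg cv.
by apply: funext => K /=; rewrite (integral_level (@fc K)).
Qed.

End OuterIntegral.

(** * The local density *)

Lemma dens_morph (C C' : numFieldType) (f : {rmorphism C -> C'}) its g t :
  f (dens its g t) = dens its (f \o g) t.
Proof.
elim: its t => //= it its IH t.
rewrite /avg rmorphM fmorphV rmorph_nat rmorph_sum; congr (_ * _).
by apply: eq_bigr => z _; exact: IH.
Qed.

Lemma dens_sum (C : numFieldType) (I : finType) (g : I -> int -> C) its t :
  \sum_a dens its (g a) t = dens its (fun z => \sum_a g a z) t.
Proof.
elim: its t => //= it its IH t; rewrite /avg -mulr_sumr exchange_big /=.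
by congr (_ * _); apply: eq_bigr => z _; exact: IH.
Qed.

Lemma odd_items n (beta : 'I_n -> Z2) (r : 'I_n -> nat) k :
  (forall i, beta i \is a GRing.unit) ->
  all (fun it => ~~ (2 %| it.1.1)%Z && (it.2 == k)) (items beta r k).
Proof.
move=> ub; apply/allP => _ /mapP[i _ ->] /=; rewrite eqxx andbT.
by have := @Z2_unit_odd _ k.+1 (ub i) isT; move: (beta i k.+1) => x; lia.
Qed.

Section LocalDensity.
Variables (R : realType) (n : nat) (P : 'M[Z2]_n).
Hypothesis uP : P \in unitmx.
Variables (dv : {measure set (borel (V2 n)) -> \bar R})
          (ds : {measure set (borel Q2) -> \bar R}).
Hypothesis haar_dv : normalized_haar <<s @open (V2 n) >> (@L2 n) dv.
Hypothesis haar_ds : normalized_haar <<s @open Q2 >> Z2_in_Q2 ds.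
Variables (beta : 'I_n -> Z2) (r : 'I_n -> nat) (phi : V2 n -> Q2) (eta : Z2).
Hypothesis phiE : forall y : 'rV[Z2]_n,
  phi (lattice_pt P y) = toQ2 (\sum_i beta i * 2 ^+ r i * y 0 i ^+ 2).
Hypothesis beta_unit : forall i, beta i \is a GRing.unit.
Hypothesis n6 : (6 <= n)%N.

Let F (s : Q2) : R[i] := cintegral dv (fun w : borel (V2 n) =>
  e2 R (s * (phi w - toQ2 eta)) * real_complex R (\1_(@L2 n) w)).
Let Phi k (A : int) : R[i] :=
  dens (items beta r k) (fun z => pow2_char R k (A * z)) (eta k)%:Z.

Lemma inner_levels u k A : congz k u A -> F (toQ2 u / 2 ^+ k) = Phi k A.
Proof.
by move=> uA; apply: (inner_integral uP haar_dv phiE uA); exact: congz_res.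
Qed.

(** For odd [A], or for k = 0, multiplication by [A] leaves the kernel of the character unchanged,
    so the Gauss sum bound holds in each of the [n] variables. *)
Lemma inner_bound k A : (k == 0)%N || ~~ (2 %| A)%Z ->
  complex.Re (Phi k A) ^+ 2 + complex.Im (Phi k A) ^+ 2
  <= ((\prod_i 2 ^+ (r i).+1) / 8 ^+ k) ^+ 2.
Proof.
move=> kA; pose chi z := pow2_char R k (A * z).
have chiD x y : chi (x + y) = chi x * chi y by rewrite /chi mulrDr pow2_charD.
have chiN x : (chi x)^* = chi (- x) by rewrite /chi mulrN pow2_charN.
have chi1 z : (chi z == 1) = (2 ^+ k %| z)%Z.
  rewrite pow2_char1; case/orP: kA => [/eqP->|A2]; first by rewrite !dvd1z.
  rewrite Gauss_dvdzr // coprimezE abszX coprimeXl // coprime2n.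
  by move: A2; lia.
have := dens_char_bound chiD chiN chi1 (eta k)%:Z (odd_items r k beta_unit).
rewrite -/(Phi k A) -add_Re2_Im2 big_map big_enum /=.
rewrite (_ : \prod_i _ = real_complex R (\prod_i (2 ^+ (r i).+1 / 2 ^+ k))).
  rewrite lecR => /le_trans; apply.
  rewrite big_split /= prodr_const card_ord exprMn.
  (* As W >= 1, W may be replaced by its square; as n >= 6, 2^(kn) is at least 8^(2k). *)
  set W := \prod_i _; have W1 : 1 <= W.
    rewrite /W; elim/big_ind : _ => // [x y|i _]; first exact: mulr_ege1.
    by rewrite exprn_ege1 // ler1n.
  apply: ler_pM; rewrite ?exprn_ge0 ?invr_ge0 ?exprn_ge0 //.
  - by rewrite (le_trans ler01).
  - by rewrite expr2 ler_peMr // (le_trans ler01).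
  rewrite !exprVn lef_pV2 ?posrE ?exprn_gt0 //.
  have -> : (8 : R) = 2 ^+ 3 by ring.
  rewrite -!exprM; apply: ler_weXn2l; first by rewrite ler1n.
  by rewrite mulnC -mulnA leq_mul2l n6 orbT.
rewrite rmorph_prod; apply: eq_bigr => i _.
by rewrite rmorphM fmorphV !rmorphXn rmorph_nat.
Qed.

(** Orthogonality of characters: the sum over [a] of the characters of a z is the point mass at
    z. *)
Lemma sum_levels k : \sum_(a < 2 ^ k) Phi k a%:Z
  = real_complex R (dens (items beta r k) (delta R k) (eta k)%:Z).
Proof.
rewrite dens_sum dens_morph; congr dens; apply: funext => z /=.
rewrite -(big_mkord xpredT (fun a => pow2_char R k (a%:Z * z))).
under eq_bigr do rewrite mulrC.
rewrite (char_sum (@pow2_charD R k) (@pow2_char1 R k)) /delta.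
by case: ifP; rewrite ?rmorph0 // rmorphXn rmorph_nat.
Qed.

(** [outer_integral] is applied to the real and imaginary parts separately. The finite sums are real
    by [sum_levels], so the imaginary part is a limit of zeros. *)
Lemma density_cvg :
  [/\ (fun k => dens (items beta r k) (delta R k) (eta k)%:Z : R) @ \oo
        --> (complex.Re (cintegral ds (F : borel Q2 -> R[i])) : R) &
      complex.Im (cintegral ds (F : borel Q2 -> R[i])) = 0].
Proof.
pose W : R := \prod_i 2 ^+ (r i).+1.
have W0 : 0 <= W by apply: prodr_ge0 => i _; rewrite exprn_ge0.
have bnd (x y : R) k :
    x ^+ 2 + y ^+ 2 <= (W / 8 ^+ k) ^+ 2 -> `|x| <= W / 8 ^+ k.
  move=> h; have B0 : 0 <= W / 8 ^+ k by rewrite divr_ge0 // exprn_ge0.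
  rewrite -(@ler_pXn2r _ 2) ?nnegrE // real_normK ?num_real //.
  by apply: le_trans h; rewrite lerDl sqr_ge0.
have sums k : (\sum_(a < 2 ^ k) complex.Re (Phi k a%:Z)
      = dens (items beta r k) (delta R k) (eta k)%:Z)
    /\ \sum_(a < 2 ^ k) complex.Im (Phi k a%:Z) = 0.
  have -> : \sum_(a < 2 ^ k) complex.Re (Phi k a%:Z)
      = complex.Re (\sum_(a < 2 ^ k) Phi k a%:Z).
    by elim/big_ind2 : _ => // -[a b] _ [a' b'] _ -> ->.
  have -> : \sum_(a < 2 ^ k) complex.Im (Phi k a%:Z)
      = complex.Im (\sum_(a < 2 ^ k) Phi k a%:Z).
    by elim/big_ind2 : _ => // -[a b] _ [a' b'] _ -> ->.
  by rewrite sum_levels.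
split.
  have := @outer_integral R ds haar_ds (fun s => complex.Re (F s))
    (fun k A => complex.Re (Phi k A)) W.
  under [X in X @ _]funext => k do rewrite (sums k).1.
  apply=> // [u k A uA|k A kA]; first by rewrite (inner_levels uA).
  exact: bnd (inner_bound kA).
have := @outer_integral R ds haar_ds (fun s => complex.Im (F s))
    (fun k A => complex.Im (Phi k A)) W.
under [X in X @ _]funext => k do rewrite (sums k).2.
move=> h; have {}h : (fun=> 0 : R) @ \oo -->
    (Rintegral ds [set: borel Q2] (fun s => complex.Im (F s)) : R).
  apply: h => // [u k A uA|k A kA]; first by rewrite (inner_levels uA).
  by have := inner_bound kA; rewrite addrC; exact: bnd.
exact: (cvg_unique (@Rhausdorff R) h (@cvg_cst R 0 nat \oo _)).
Qed.

Lemma density_bounds (d : R) K0 :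
  (forall k, (K0 <= k)%N ->
     d <= dens (items beta r k) (delta R k) (eta k)%:Z <= 2) ->
  real_complex R d <= cintegral ds (F : borel Q2 -> R[i]) <= 2.
Proof.
move=> bd; have [cv im] := density_cvg.
have E := cvg_lim (@Rhausdorff R) cv.
have icv : cvgn (fun k => dens (items beta r k) (delta R k) (eta k)%:Z : R).
  by apply/cvg_ex; eexists; exact: cv.
have -> : (2 : R[i]) = real_complex R 2 by rewrite rmorph_nat.
rewrite !lecE im -E !eqxx !andTb; apply/andP; split.
  by apply: limr_ge => //; exists K0 => // k /bd/andP[].
by apply: limr_le => //; exists K0 => // k /bd/andP[].
Qed.

End LocalDensity.

(** * Application to the admissible lattices *)

Lemma admissible_patterns r : admissible r ->
  take 4 r \in patterns /\ ~~ nonprimitive (take 4 r).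
Proof.
move=> [i []] [->]; case: i => [|[|[|[|i]]]] //.
Qed.

(** The four leading items form the quaternary part, and the fifth, which exists as n >= 5, is the
    extra variable of [dens_bounds]. *)
Lemma items_bounds (R : realType) n (beta : 'I_n -> Z2) (r : n.-tuple nat) k t
    (J := (nth 0%N r 4).+1) :
  (5 <= n)%N -> (forall i, beta i \is a GRing.unit) -> admissible r ->
  (J.+2 <= k)%N ->
  (2^-1 ^+ J) ^+ (n - 4) * 32^-1 ^+ J
    <= dens (items beta (tnth r) k) (delta R k) t <= 2.
Proof.
move=> n5 ub /admissible_patterns[pat prim] Jk; set its := items _ _ _.
have szi : size its = n by rewrite size_map size_enum_ord.
have exps : [seq it.1.2 | it <- its] = r.
  rewrite /its /items -map_comp -[RHS](map_tnth_enum r).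
  exact: eq_map.
have pits : all (proper_item k) its.
  apply/allP => it /(allP (odd_items (tnth r) k ub))/andP[b2 /eqP mk].
  by rewrite /proper_item b2 mk leqnn.
have e4 : [seq it.1.2 | it <- take 4 its] = take 4 r by rewrite map_take exps.
have d4 : [seq it.1.2 | it <- drop 4 its] = drop 4 r by rewrite map_drop exps.
rewrite -[its](cat_take_drop 4) in pits *.
have s4 : size (drop 4 its) = (n - 4)%N by rewrite size_drop szi.
case E : (drop 4 its) d4 s4 pits => [|it its'] d4 s4 pits.
  by move: s4 => /=; lia.
have J4 : J = it.1.2.+1.
  by rewrite /J -[4%N]addn0 -nth_drop -d4.
rewrite -s4 /= J4; apply: dens_bounds; rewrite ?e4 //.
by rewrite -J4.
Qed.

Lemma phi2_lattice (V : vectType rat) (b : {dot V for idfun}) n (v : n.-tuple V)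
    (P : 'M[Z2]_n) (d : 'I_n -> Z2) :
  map_mx toQ2 P *m gram2 b v *m (map_mx toQ2 P)^T
    = diag_mx (\row_i toQ2 (d i)) ->
  forall y, phi2 b v (lattice_pt P y) = toQ2 (\sum_i d i * y 0 i ^+ 2).
Proof.
move=> PG y; rewrite /phi2 /lattice_pt map_mxM trmx_mul !mulmxA.
rewrite -[_ *m map_mx toQ2 P *m _]mulmxA -[X in X *m (map_mx toQ2 y)^T]mulmxA.
rewrite PG mul_mx_diag mxE rmorph_sum; apply: eq_bigr => i _.
by rewrite !mxE rmorphM rmorphXn [_ * toQ2 (d i)]mulrC -mulrA -expr2.
Qed.

Lemma X2_eq_L2 (V : vectType rat) n (v : n.-tuple V) (nu : V) :
  (forall i, exists t : Z2, ratr (coord v i nu) = toQ2 t) -> X2 v nu = @L2 n.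
Proof.
move=> /choice[t ht]; apply/seteqP; split=> [_ [l Ll <-] i|w Lw].
  have [u _ ul] := Ll i; rewrite !mxE ht -ul.
  by exists (u + t i); rewrite // rmorphD.
exists (w - base_change v nu); last by rewrite subrK.
move=> i; have [u _ uw] := Lw i; rewrite !mxE ht -uw.
by exists (u - t i); rewrite // rmorphB.
Qed.

Lemma coord_sum_basis (V : vectType rat) n (v : n.-tuple V) (a : rat) i :
  basis_of fullv v -> coord v i (- (a *: \sum_(j < n) tnth v j)) = - a.
Proof.
move=> hv; rewrite linearN linearZ linear_sum /= (bigD1 i) //= big1 => [|j ji].
  by rewrite (tnth_nth 0) coord_free ?(basis_free hv) // eqxx addr0 mulr1.
rewrite (tnth_nth 0) coord_free ?(basis_free hv) //.
by rewrite (negPf ji).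
Qed.

Theorem theorem3p11 (R : realType) (V : vectType rat) (b : {dot V for idfun})
  (n : nat) (v : n.-tuple V) (a : 'I_n -> nat)
  (beta : 'I_n -> Z2) (r : n.-tuple nat)
  (hn : (6 <= n)%N) (hn_even : ~~ odd n)
  (hv : basis_of fullv v)
  (ha : forall j, (0 < a j)%N)
  (hgram : forall i j, b (tnth v i) (tnth v j) = (a i)%:R *+ (i == j))
  (hgcd : \big[gcdn/0%N]_(j < n) a j = 1%N)
  (hbeta : forall i, beta i \is a GRing.unit)
  (hr : sorted leq r)
  (hL2 : L2_isom_diag b v (fun i => beta i * 2 ^+ tnth r i))
  (hadm : admissible r) :
  exists2 d : R, 0 < d &
    forall (dv : {measure set (borel (V2 n)) -> \bar R})
           (ds : {measure set (borel Q2) -> \bar R})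
           (c : int) (N : nat) (h : rat),
      normalized_haar <<s @open (V2 n) >> (@L2 n) dv ->
      normalized_haar <<s @open Q2 >> Z2_in_Q2 ds ->
      (0 < N)%N -> odd N -> coprimez c N%:Z ->
      h != 0 ->
      (exists m : int,
        h - \sum_(j < n) (a j)%:R * (c%:~R / N%:R) ^+ 2
          = 8 * N%:R^-1 * m%:~R) ->
      let nu := - ((c%:~R / N%:R) *: \sum_(j < n) tnth v j) in
      real_complex R d <= local_density b v dv ds h nu <= 2.
Proof.
have [P uP PG] := hL2; pose J := (nth 0%N r 4).+1.
(* [J] is one more than the fifth exponent. The first factor pays for the [n - 4] variables beyond
   the leading four, the second is the bound of [dens_lower]; both depend only on [n] and [r]. *)
exists ((2^-1 ^+ J) ^+ (n - 4) * 32^-1 ^+ J).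
  by rewrite mulr_gt0 // !exprn_gt0 // invr_gt0.
move=> dv ds c N h haar_dv haar_ds N0 oN _ _ [m hm]; cbv zeta.
set nu := - (_ *: _).
have N0' : (N%:R : rat) != 0 by rewrite pnatr_eq0 -lt0n.
(* The odd number N^2 clears the denominators in the congruence for [h], so [h] lies in Z_2. *)
have [eta hE] : exists eta, ratr h = toQ2 eta.
  apply: (@ratr_odd_denom _
    (\sum_(j < n) (a j)%:Z * c ^+ 2 + 8 * N%:Z * m) (N ^ 2)).
    by rewrite oddX oN orbT.
  have -> : h = \sum_(j < n) (a j)%:R * (c%:~R / N%:R) ^+ 2
      + 8 * N%:R^-1 * m%:~R.
    by rewrite -hm addrC subrK.
  rewrite mulrDl mulr_suml intrD natrX !intrM rmorph_sum /=; congr (_ + _).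
    apply: eq_bigr => j _; rewrite intrM rmorphXn /= expr_div_n -mulrA divfK //.
    by rewrite expf_neq0.
  by field.
have XL : X2 v nu = @L2 n.
  apply: X2_eq_L2 => i; rewrite coord_sum_basis //.
  apply: (@ratr_odd_denom _ (- c) N) => //.
  by rewrite mulNr divfK // mulrNz.
rewrite /local_density XL hE.
apply: (@density_bounds R n P uP dv ds haar_dv haar_ds beta (tnth r)
  (phi2 b v) eta (phi2_lattice PG) hbeta hn _ J.+2) => k Jk.
by apply: items_bounds => //; apply: leq_trans hn.
Qed.
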